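(* Let $p=2$, $\theta\ge0$ and $\alpha=1$. Then there exists $\mu_0>0$ such that, for all $0<\mu<\mu_0$, $d(\theta,\alpha,\mu)$ is not achieved; that is, there is no nonzero $u\in W^{1,2}_{1,\theta}(0,\infty)$ with $$\int_0^\infty A_{2,\mu}\left(\frac{|u(x)|}{\|u\|_{W^{1,2}_{1,\theta}(0,\infty)}}\right)d\lambda_\theta(x)=d(\theta,1,\mu).$$
   Context: For $\beta\ge 0$ put $\omega_\beta=\frac{2\pi^{(1+\beta)/2}}{\Gamma((1+\beta)/2)}$ and $d\lambda_\beta(x)=\omega_\beta x^\beta dx$ on $(0,\infty)$. $L^2_\beta(0,\infty)$ is the space of measurable $u$ on $(0,\infty)$ with $\|u\|_{L^2_\beta(0,\infty)}=\left(\int_0^\infty|u|^2\,d\lambda_\beta\right)^{1/2}<\infty$. $W^{1,2}_{1,\theta}(0,\infty)=\{u\in L^2_\theta(0,\infty):\ u'\in L^2_1(0,\infty),\ \lim_{x\to\infty}u(x)=0\}$ (with $u$ locally absolutely continuous, $u'$ its derivative), with norm $\|u\|_{W^{1,2}_{1,\theta}(0,\infty)}=\left(\|u'\|^2_{L^2_1(0,\infty)}+\|u\|^2_{L^2_\theta(0,\infty)}\right)^{1/2}$. For $t\ge0$, $A_{2,\mu}(t)=e^{\mu t^2}-1$, and $$d(\theta,1,\mu):=\sup_{0\ne u\in W^{1,2}_{1,\theta}(0,\infty)}\int_0^\infty A_{2,\mu}\left(\frac{|u(x)|}{\|u\|_{W^{1,2}_{1,\theta}(0,\infty)}}\right)d\lambda_\theta(x).$$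 *)

(* Defs.v *)
From HB Require Import structures.
From mathcomp Require Import all_boot all_order all_algebra.
From mathcomp Require Import all_classical all_reals all_analysis.
Set Implicit Arguments.
Unset Strict Implicit.
Unset Printing Implicit Defensive.
Import Order.TTheory GRing.Theory Num.Theory.
Import numFieldTopology.Exports numFieldNormedType.Exports.
Local Open Scope classical_set_scope.
Local Open Scope ring_scope.

(* Functions on (0, +oo) are represented by total functions u : R -> R;
   no definition below depends on the values of u on (-oo, 0]. *)

Definition Gamma (R : realType) (s : R) : R :=
  \int[lebesgue_measure]_(t in `]0, +oo[) (t `^ (s - 1) * expR (- t)).

Definition omega (R : realType) (beta : R) : R :=
  2 * pi `^ ((1 + beta) / 2) / Gamma ((1 + beta) / 2).

(* The integral of f over (0, +oo) against omega_beta x^beta dx. *)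
Definition lambda_int (R : realType) (beta : R) (f : R -> R) : \bar R :=
  (\int[lebesgue_measure]_(x in `]0%R, +oo[)
     (f x * (omega beta * x `^ beta))%:E)%E.

Definition L2_norm (R : realType) (beta : R) (u : R -> R) : \bar R :=
  (lambda_int beta (fun x => `|u x| ^+ 2)%R `^ 2^-1)%E.

Definition in_L2 (R : realType) (beta : R) (u : R -> R) : Prop :=
  measurable_fun (`]0, +oo[ : set R) u /\ (L2_norm beta u < +oo)%E.

Definition abs_continuous (R : realType) (a b : R) (f : R -> R) : Prop :=
  forall e : R, 0 < e -> exists2 d : R, 0 < d &
    forall (n : nat) (x y : 'I_n -> R),
      (forall i, [/\ a <= x i, x i <= y i & y i <= b]) ->
      trivIset [set: 'I_n] (fun i => [set` `]x i, y i[]) ->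
      \sum_(i < n) (y i - x i) < d ->
      \sum_(i < n) `|f (y i) - f (x i)| < e.

Definition loc_abs_continuous (R : realType) (f : R -> R) : Prop :=
  forall a b : R, 0 < a -> a < b -> abs_continuous a b f.

(* A locally absolutely continuous u is derivable almost everywhere on
   (0, +oo), and derive1 u is its pointwise derivative there; on the remaining
   null set derive1 u takes a default value, which no integral sees. *)
Definition in_W (R : realType) (theta : R) (u : R -> R) : Prop :=
  [/\ in_L2 theta u,
      loc_abs_continuous u,
      in_L2 1 (derive1 u) &
      u x @[x --> +oo] --> (0 : R)].

Definition W_norm (R : realType) (theta : R) (u : R -> R) : R :=
  Num.sqrt (fine (L2_norm 1 (derive1 u)) ^+ 2 + fine (L2_norm theta u) ^+ 2).

(* Elements of W are continuous on (0, +oo), so this is the same as not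
   vanishing almost everywhere there. *)
Definition nonzero (R : realType) (u : R -> R) : Prop :=
  exists2 x : R, 0 < x & u x != 0.

Definition A2 (R : realType) (mu t : R) : R := expR (mu * t ^+ 2) - 1.

Definition TM_functional (R : realType) (theta mu : R) (u : R -> R) : \bar R :=
  lambda_int theta (fun x => A2 mu (`|u x| / W_norm theta u)).

Definition TM_sup (R : realType) (theta mu : R) : \bar R :=
  ereal_sup [set TM_functional theta mu u |
             u in [set u : R -> R | in_W theta u /\ nonzero u]].

(* Main.v *)
From HB Require Import structures.
Require Import Defs.
From mathcomp Require Import all_boot all_order all_algebra.
From mathcomp Require Import all_classical all_reals all_analysis.
From mathcomp Require Import measurable_realfun.
From mathcomp Require Import ring lra.
Set Implicit Arguments.
Unset Strict Implicit.
Unset Printing Implicit Defensive.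
Import Order.TTheory GRing.Theory Num.Theory.
Import numFieldTopology.Exports numFieldNormedType.Exports.
Local Open Scope classical_set_scope.
Local Open Scope ring_scope.

(** Write [a] and [b] for the squared norms of [u'] in [L^2_1] and of [u] in
[L^2_theta], so that the squared norm of [u] is [N^2 = a + b].

Functions that spread out are the best competitors.  Since [e^t - 1 >= t], the
functional is at least [mu b / (a + b)]; the hat functions [max(0, 1 - x/T)]
keep [a] bounded while [b] tends to infinity with [T], so the supremum is at
least [mu] (lemma [TM_sup_ge]).

On the other hand, for small [mu] every nonzero [u] stays strictly below [mu].
The linear part of the exponential contributes [mu b / N^2 = mu - mu a / N^2],
and the remainder, which is at least quadratic in [u^2], is at most
[C mu^2 a b / N^4]: the extra factor [a] makes it smaller than half of the loss
[mu a / N^2] once [mu] is small, whence the bound [mu (1 - a / (2 N^2))] of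
[TM_functional_le].  Finally [a > 0], because a function with zero derivative that
vanishes at infinity is zero ([energy_derivative_gt0]).

The remainder estimate is a scale invariant exponential inequality
([sqr_exp_integral_le]), applied to [v = u / sqrt a].  By the Cauchy-Schwarz
inequality with the weight [x] one has [(v y - v x)^2 <= k ln (y / x)] with
[k = 1 / omega_1] ([increment_sqr_le]), and besides the limit of [v] at infinity
this inequality is all that is used: there is no rearrangement.  Let [x0] be, up
to a factor [2], the last point where [|v|] is at least [1].  Beyond [2 x0] the
remainder is at most [v^2].  Below [2 x0] the function [v^2] grows at most
logarithmically towards the origin, so [exp (2 c v^2)] is dominated by a multiple
of [sqrt (x0 / x)], whose integral against [x^theta dx] has the size of
[x0^(theta + 1)]; and the same logarithmic inequality keeps [|v| >= 1/2] on
[(d x0, x0)] for some fixed [d < 1], so that the integral of [v^2] has at least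
that size.

The increment inequality rests on [|f b - f a| <= \int_a^b |f'|] for an absolutely
continuous [f] ([abs_continuous_increment_le]).  The total variation [T] of [f] is
again absolutely continuous, so [f = T - (T - f)] is a difference of
nondecreasing absolutely continuous functions; the Stieltjes measure of such a
function does not charge Lebesgue null sets, its Radon-Nikodym density is integrable, and the
Lebesgue differentiation theorem identifies that density with the derivative
almost everywhere. *)

(** * Absolute continuity and total variation *)

Section interval_lists.
Variable R : realType.
Implicit Types (a b : R) (f : R -> R) (s : seq (R * R)).

Definition nonoverlapping s :=
  pairwise (fun p q : R * R => (p.2 <= q.1) || (q.2 <= p.1)) s.

Definition subintervals a b s :=
  all (fun p : R * R => [&& a <= p.1, p.1 <= p.2 & p.2 <= b]) s.

Definition total_length s := \sum_(p <- s) (p.2 - p.1).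

Definition total_increment f s := \sum_(p <- s) `|f p.2 - f p.1|.

(** Absolute continuity over lists rather than over families indexed by ['I_n]:
in a list, an interval can be replaced by the steps of one of its partitions. *)
Definition list_ac a b f := forall e : R, 0 < e -> exists2 d : R, 0 < d &
  forall s, subintervals a b s -> nonoverlapping s -> total_length s < d ->
    total_increment f s <= e.

Lemma abs_continuous_list_ac a b f : abs_continuous a b f -> list_ac a b f.
Proof.
move=> ac e e0; have [d d0 acd] := ac e e0; exists d => // s ss ns sd.
apply: ltW; rewrite /total_increment (big_nth (0, 0)) big_mkord.
apply: (acd _ (fun i => (nth (0, 0) s i).1) (fun i => (nth (0, 0) s i).2)).
- by move=> i; have /and3P[] := all_nthP (0, 0) ss i (ltn_ord i).
- apply/trivIsetP => i j _ _ ij.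
  wlog lij : i j ij / (i < j)%N.
    move=> H; move: (ij); rewrite -val_eqE neq_ltn => /orP[/H|ji]; first exact.
    by rewrite setIC; apply: H => //; rewrite eq_sym.
  have /(pairwiseP (0, 0))/(_ i j) := ns.
  rewrite !inE => /(_ (ltn_ord i) (ltn_ord j) lij) /orP[] h.
  + apply/seteqP; split => // z /= []; rewrite !in_itv/= => /andP[_ zi] /andP[jz _].
    by move: (lt_trans jz zi); rewrite ltNge h.
  + apply/seteqP; split => // z /= []; rewrite !in_itv/= => /andP[zi _] /andP[_ jz].
    by move: (lt_trans zi jz); rewrite ltNge h.
- by move: sd; rewrite /total_length (big_nth (0, 0)) big_mkord.
Qed.

Lemma list_acB a b f g : list_ac a b f -> list_ac a b g ->
  list_ac a b (fun x => f x - g x).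
Proof.
move=> acf acg e e0; have e20 : 0 < e / 2 by rewrite divr_gt0.
have [d d0 fd] := acf _ e20; have [d' d'0 gd] := acg _ e20.
exists (Num.min d d') => [|s ss ns]; first by rewrite lt_min d0.
rewrite lt_min => /andP[sd sd']; rewrite [leRHS]splitr.
apply: le_trans (lerD (fd s ss ns sd) (gd s ss ns sd')).
rewrite /total_increment -big_split/=; apply: ler_sum => p _.
by rewrite opprD addrACA -opprD; exact: ler_normB.
Qed.

Lemma list_ac_sub a b a' b' f : a <= a' -> b' <= b -> list_ac a b f ->
  list_ac a' b' f.
Proof.
move=> aa bb ac e /ac[d d0 H]; exists d => // s ss; apply: H.
apply: sub_all ss => p /and3P[ap pp pb].
by rewrite (le_trans aa ap) pp (le_trans pb bb).
Qed.

Lemma subintervals_steps x y (t : seq R) : itv_partition x y t ->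
  subintervals x y (pairmap pair x t).
Proof.
elim: t x => [|h t ih] x //= [/= /andP[xh ht] /eqP hy].
have py : itv_partition h y t by split => //; apply/eqP.
have hle : h <= y by exact: itv_partition_le py.
rewrite lexx (ltW xh) hle/=.
by apply: sub_all (ih _ py) => p /and3P[hp pp py']; rewrite (le_trans (ltW xh) hp) pp.
Qed.

Lemma nonoverlapping_steps x y (t : seq R) : itv_partition x y t ->
  nonoverlapping (pairmap pair x t).
Proof.
elim: t x => [|h t ih] x //= [/= /andP[xh ht] /eqP hy].
have py : itv_partition h y t by split => //; apply/eqP.
rewrite ih// andbT.
by apply: sub_all (subintervals_steps py) => p /= /and3P[-> _ _].
Qed.

Lemma total_length_steps x y (t : seq R) : itv_partition x y t ->
  total_length (pairmap pair x t) = y - x.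
Proof.
rewrite /total_length.
elim: t x => [|h t ih] x /= [/=]; first by move=> _ /eqP ->; rewrite big_nil subrr.
move=> /andP[xh ht] hy; by rewrite big_cons/= ih//= addrC subrKA.
Qed.

Lemma total_increment_steps x y f (t : seq R) : itv_partition x y t ->
  total_increment f (pairmap pair x t) = variation x y f t.
Proof.
rewrite /total_increment.
elim: t x => [|h t ih] x [/=].
  by move=> _ /eqP ->; rewrite big_nil variation_nil.
move=> /andP[xh ht] hy; rewrite big_cons/= ih//= /variation/=.
by rewrite big_nat_recl.
Qed.

Lemma total_increment_cat f s1 s2 :
  total_increment f (s1 ++ s2) = total_increment f s1 + total_increment f s2.
Proof. exact: big_cat. Qed.

(** A modulus for the increments of [f] is also one for its total variation.  The
intervals of [l] still count with their variation, those of [m] only with their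
increment; an arbitrary partition of the head of [l] is moved to [m], and the
supremum over these partitions is taken afterwards. *)
Lemma total_variation_list_le a b f (e d : R) :
  (forall s, subintervals a b s -> nonoverlapping s -> total_length s < d ->
    total_increment f s <= e) ->
  forall l m, subintervals a b (l ++ m) -> nonoverlapping (l ++ m) ->
    total_length (l ++ m) < d ->
  (\sum_(p <- l) total_variation p.1 p.2 f + (total_increment f m)%:E <= e%:E)%E.
Proof.
move=> H; elim=> [|[x y] l ih] m; first by rewrite big_nil add0e lee_fin; exact: H.
rewrite big_cons/= => /andP[/and3P[ax]].
rewrite le_eqVlt => /predU1P[<- xb sl /andP[_ nl]|xy yb sl /andP[xyl nl]].
  rewrite /total_length big_cons/= subrr add0r => ld.
  by rewrite total_variationxx add0e; exact: ih.
move=> ld.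
have tv0 : (0 <= \sum_(p <- l) total_variation p.1 p.2 f)%E.
  rewrite big_seq; apply: sume_ge0 => p pl; apply: total_variation_ge0.
  by move: sl; rewrite /subintervals all_cat => /andP[/allP/(_ _ pl)/and3P[]].
have K t : itv_partition x y t ->
    (\sum_(p <- l) total_variation p.1 p.2 f + (variation x y f t)%:E +
      (total_increment f m)%:E <= e%:E)%E.
  move=> pt; rewrite -(total_increment_steps _ pt) -addeA -EFinD -total_increment_cat.
  apply: ih.
  - move: sl; rewrite /subintervals !all_cat => /andP[-> ->]; rewrite andbT/=.
    apply: sub_all (subintervals_steps pt) => p /and3P[xp pp py].
    by rewrite (le_trans ax xp) pp (le_trans py yb).
  - have step (q : R * R) : (y <= q.1) || (q.2 <= x) ->
        all (fun p : R * R => (p.2 <= q.1) || (q.2 <= p.1)) (pairmap pair x t).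
      move=> xyq; apply: sub_all (subintervals_steps pt) => p /and3P[xp pp py].
      case/orP: xyq => h; apply/orP; [left|right].
        by rewrite (le_trans py h).
      by rewrite (le_trans h xp).
    move: nl xyl; rewrite /nonoverlapping !pairwise_cat all_cat/=.
    move=> /and3P[lm -> pm] /andP[xyl xym].
    rewrite pm !andbT/= -/(nonoverlapping _) (nonoverlapping_steps pt)/=.
    rewrite allrel_catr lm andbT/=; apply/andP; split.
      apply/allrelP => q p ql pp.
      by have /allP/(_ _ pp) := step _ (allP xyl _ ql); rewrite orbC.
    rewrite andbT; apply/allrelP => p q pp qm.
    exact: (allP (step _ (allP xym _ qm))).
  - move: ld; rewrite /total_length big_cons !big_cat/=.
    by rewrite [in X in _ -> X]addrCA -/(total_length (pairmap _ _ _)) (total_length_steps pt).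
have tvfin : (\sum_(p <- l) total_variation p.1 p.2 f)%E \is a fin_num.
  rewrite ge0_fin_numE//; have := K _ (itv_partition1 xy).
  rewrite -addeA -EFinD; apply: contra_leT; rewrite -leNgt leye_eq => /eqP ->.
  by rewrite addye// ltry.
rewrite -(fineK tvfin) -addeA -EFinD -leeBrDr// -EFinB.
apply: ge_ereal_sup => _ [_ [t pt <-] <-].
rewrite lee_fin lerBrDr; move: (K _ pt); rewrite -(fineK tvfin) -!EFinD lee_fin.
lra.
Qed.
End interval_lists.

Section ac_variation.
Variable R : realType.
Implicit Types (a b : R) (f : R -> R).

Lemma list_ac_total_variation a b f : list_ac a b f ->
  forall e : R, 0 < e -> exists2 d : R, 0 < d & forall l, subintervals a b l ->
    nonoverlapping l -> total_length l < d ->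
    (\sum_(p <- l) total_variation p.1 p.2 f <= e%:E)%E.
Proof.
move=> ac e /ac[d d0 H]; exists d => // l sl nl ll.
have := total_variation_list_le H (l := l) (m := [::]).
by rewrite cats0 /total_increment big_nil adde0; exact.
Qed.

(** With the modulus for [e = 1], the variation over any interval shorter than [d]
is at most [1], and finitely many steps of length [d / 2] lead from [a] to [b]. *)
Lemma list_ac_total_variation_fin a b f : a <= b -> list_ac a b f ->
  total_variation a b f \is a fin_num.
Proof.
move=> ab /list_ac_total_variation/(_ _ ltr01)[d d0 H].
rewrite ge0_fin_numE ?total_variation_ge0//.
pose c k := Num.min b (a + (d / 2) *+ k).
have ac k : a <= c k by rewrite le_min ab lerDl mulrn_wge0// ltW// divr_gt0.
suff K k : (total_variation a (c k) f < +oo)%E.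
  have [k hk] : exists k, b <= a + (d / 2) *+ k.
    exists (Num.bound `|(b - a) / (d / 2)|).
    rewrite -lerBlDl -mulr_natr mulrC -ler_pdivrMr ?divr_gt0//.
    by apply/ltW/(le_lt_trans (ler_norm _)); exact: archi_boundP.
  by have := K k; rewrite /c min_l.
elim: k => [|k ih].
  by rewrite /c mulr0n addr0 min_r// total_variationxx ltry.
have cc : c k <= c k.+1.
  rewrite le_min ge_min lexx/= ge_min lerD2l mulrS lerDr.
  by rewrite (ltW (divr_gt0 d0 _)) ?orbT.
rewrite (total_variationD _ (ac k) cc) lte_add_pinfty//.
have := H [:: (c k, c k.+1)]; rewrite /total_length !big_seq1/= => h.
apply: le_lt_trans (h _ _ _) (ltry _) => //=.
  by rewrite ac cc ge_min lexx.
rewrite ltrBlDr /c mulrS; case: (leP b (a + (d / 2) *+ k)) => h1.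
  by rewrite gt_min ltrDr d0.
rewrite gt_min; apply/orP; right.
by rewrite addrCA ltrD2r ltr_pdivrMr// ltr_pMr// ltr1n.
Qed.

Lemma total_variationB a b f x y : list_ac a b f -> a <= x -> x <= y -> y <= b ->
  fine (total_variation a y f) - fine (total_variation a x f) =
  fine (total_variation x y f).
Proof.
move=> ac ax xy yb.
have tx : total_variation a x f \is a fin_num.
  by apply: list_ac_total_variation_fin => //;
    apply: list_ac_sub ac => //; exact: le_trans yb.
have ty : total_variation x y f \is a fin_num.
  by apply: list_ac_total_variation_fin => //; exact: list_ac_sub ac.
by rewrite (total_variationD _ ax xy) fineD// addrAC subrr add0r.
Qed.

Lemma list_ac_fine_total_variation a b f : list_ac a b f ->
  list_ac a b (fun x => fine (total_variation a x f)).
Proof.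
move=> ac e e0; have [d d0 H] := list_ac_total_variation ac e0.
exists d => // s ss ns sd; have := H s ss ns sd.
rewrite -lee_fin; apply: le_trans.
rewrite /total_increment -sumEFin big_seq [leRHS]big_seq.
apply: lee_sum => p ps; move: (allP ss _ ps) => /and3P[ap pp pb].
rewrite (total_variationB ac)// ger0_norm ?fine_ge0 ?total_variation_ge0//.
rewrite fineK//; apply: list_ac_total_variation_fin => //.
exact: list_ac_sub ac.
Qed.

Lemma fine_total_variation_nondecreasing a b f : list_ac a b f ->
  forall x y, a <= x -> x <= y -> y <= b ->
  fine (total_variation a x f) <= fine (total_variation a y f).
Proof.
move=> ac x y ax xy yb.
by rewrite -subr_ge0 (total_variationB ac)// fine_ge0// total_variation_ge0.
Qed.

(** Together with the previous lemma, the Jordan decomposition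
[f = T - (T - f)], whose two parts are again absolutely continuous. *)
Lemma fine_total_variationB_nondecreasing a b f : list_ac a b f ->
  forall x y, a <= x -> x <= y -> y <= b ->
  fine (total_variation a x f) - f x <= fine (total_variation a y f) - f y.
Proof.
move=> ac x y ax xy yb.
have tv : total_variation x y f \is a fin_num.
  by apply: list_ac_total_variation_fin => //; exact: list_ac_sub ac.
have : f y - f x <= fine (total_variation x y f).
  by apply: le_trans (ler_norm _) _; rewrite -lee_fin fineK// total_variation_ge.
rewrite -(total_variationB ac)//; lra.
Qed.
End ac_variation.

(** * Densities of absolutely continuous functions *)

Section densities.
Variable R : realType.
Local Notation mu := (@lebesgue_measure R).

(** The components of a bounded open set, given by their end points.  Empty
components are represented by the pair [(a, a)], which lies to the left of all the
others, so that the pairs never overlap. *)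
Lemma bounded_open_intervals (U : set R) (a b : R) : open U -> U `<=` `]a, b[ ->
  exists p : nat -> R * R, [/\ forall k, (p k).1 <= (p k).2,
    forall i j, i != j -> ((p i).2 <= (p j).1) || ((p j).2 <= (p i).1),
    trivIset setT (fun k => `](p k).1, (p k).2[%classic) &
    U = \bigcup_k `](p k).1, (p k).2[%classic].
Proof.
move=> oU Uab.
have oo k : exists p : R * R, (p = (a, a) \/ a <= p.1 < p.2) /\
    open_disjoint_itv oU k = `]p.1, p.2[%classic.
  set I := open_disjoint_itv oU k.
  have Iab : I `<=` `]a, b[.
    apply: subset_trans Uab; rewrite [X in _ `<=` X](open_disjoint_itv_bigcup oU).
    exact: bigcup_sup.
  have [->|/set0P[z Iz]] := eqVneq I set0.
    by exists (a, a); split; [left|rewrite /= set_itv_ge// bnd_simp ltxx].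
  have lI : lbound I a by move=> r /Iab; rewrite /= in_itv/= => /andP[/ltW].
  have ub : has_ubound I.
    by exists b => r /Iab; rewrite /= in_itv/= => /andP[_ /ltW].
  have IE : I = `]inf I, sup I[%classic.
    have := interval_bounded_interior (@open_disjoint_itv_is_interval _ _ oU k)
      (ex_intro _ a lI) ub.
    have /interior_id -> := @open_disjoint_itv_open _ _ oU k.
    by move=> h; rewrite [LHS]h set_itvoo.
  exists (inf I, sup I); split => //; right => /=.
  move: (Iz); rewrite {1}IE/= in_itv/= => /andP[h1 h2].
  by rewrite (lt_trans h1 h2) lb_le_inf//; exists z.
pose p k := sval (cid (oo k)).
have pE k : open_disjoint_itv oU k = `](p k).1, (p k).2[%classic.
  by rewrite /p; case: cid => q [].
have pa k : p k = (a, a) \/ a <= (p k).1 < (p k).2.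
  by rewrite /p; case: cid => q [].
have tp : trivIset setT (fun k => `](p k).1, (p k).2[%classic).
  by rewrite -(funext pE); exact: open_disjoint_itv_trivIset.
exists p; split => //.
- by move=> k; case: (pa k) => [->//|/andP[_ /ltW]].
- move=> i j ij; case: (pa i) => [->/=|/andP[ai ii]].
    by case: (pa j) => [->/=|/andP[-> _]//]; rewrite lexx.
  case: (pa j) => [->/=|/andP[aj jj]]; first by rewrite ai orbT.
  rewrite leNgt [X in _ || X]leNgt -negb_and; apply/negP => /andP[ji ij'].
  have /trivIsetP/(_ i j I I ij) := tp; apply/eqP/set0P.
  exists ((Num.max (p i).1 (p j).1 + Num.min (p i).2 (p j).2) / 2).
  split; rewrite /= in_itv/= /Order.max /Order.min;
    by do ! case: ifPn; rewrite -?leNgt => *; apply/andP; split; lra.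
- rewrite [LHS](open_disjoint_itv_bigcup oU).
  by apply: eq_bigcupr => k _; exact: pE.
Qed.

Lemma lebesgue_stieltjes_measure_oc (G : cumulative R R) (x y : R) : x <= y ->
  lebesgue_stieltjes_measure G `]x, y]%classic = (G y - G x)%:E.
Proof.
move=> xy; rewrite /lebesgue_stieltjes_measure /measure_extension/=.
rewrite measurable_mu_extE/=; last exact: is_ocitv.
by rewrite wlength_itv_bnd.
Qed.

(** Stieltjes measures are attached to functions on the whole line; composing with
[clamp a b] extends a function on [[a, b]] by constants. *)
Definition clamp (a b x : R) := Num.max a (Num.min b x).

Lemma clamp_itv a b x : a <= b -> a <= clamp a b x <= b.
Proof. by move=> ab; rewrite le_max lexx/= ge_max ab ge_min lexx. Qed.

Lemma clamp_id a b x : a <= x -> x <= b -> clamp a b x = x.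
Proof. by move=> ax xb; rewrite /clamp min_r// max_r. Qed.

Lemma clamp_le a b x y : x <= y -> clamp a b x <= clamp a b y.
Proof.
move=> xy; rewrite /clamp ge_max !le_max lexx/=; apply/orP; right.
by rewrite le_min ge_min lexx/= ge_min xy orbT.
Qed.

Lemma clamp_dist a b x y : a <= b -> x <= y -> clamp a b y - clamp a b x <= y - x.
Proof.
move=> ab xy; rewrite /clamp /Order.max /Order.min.
by do ! case: ifPn; rewrite -?leNgt; lra.
Qed.

Lemma list_ac_clamp_continuous a b g : a <= b -> list_ac a b g ->
  continuous (g \o clamp a b).
Proof.
move=> ab ac x; apply/cvgrPdist_le => e e0.
have [d d0 H] := ac e e0.
have K u v : u <= v -> v - u < d -> `|g (clamp a b v) - g (clamp a b u)| <= e.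
  move=> uv uvd; have := H [:: (clamp a b u, clamp a b v)].
  rewrite /total_length /total_increment !big_seq1/=; apply => //.
    rewrite andbT; have /andP[-> _] := clamp_itv u ab.
    by have /andP[_ ->] := clamp_itv v ab; rewrite clamp_le.
  by apply: le_lt_trans uvd; exact: clamp_dist.
near=> y.
have xy : `|x - y| < d by near: y; exact: cvgr_dist_lt.
have [le_xy|lt_yx] := leP x y.
  by rewrite distrC K//; move: xy; rewrite distrC ger0_norm// subr_ge0.
by rewrite K ?(ltW lt_yx)//; move: xy; rewrite gtr0_norm// subr_gt0.
Unshelve. all: by end_near. Qed.

(** Cover [N] by an open set [U] of measure less than the modulus [d] of [g].  The
Stieltjes measure of finitely many components of [U] is at most the total increment
of [g] over the clamped components, a list whose total length is less than [d]. *)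
Lemma stieltjes_null (a b : R) (g : R -> R) (G : cumulative R R) (N : set R) :
  a <= b -> list_ac a b g -> (G : R -> R) = g \o clamp a b ->
  measurable N -> mu N = 0%E ->
  lebesgue_stieltjes_measure G (N `&` `]a, b]%classic) = 0%E.
Proof.
move=> ab ac GE mN N0; apply/eqP; rewrite eq_le measure_ge0 andbT.
apply/lee_addgt0Pr => e e0; rewrite add0e.
have [d d0 H] := ac e e0.
have Ny : (mu N < +oo)%E by rewrite N0 ltry.
have [U [oU NU UN]] := lebesgue_regularity_outer mN Ny d0.
have mU : measurable U by exact: open_measurable.
have Ud : (mu U < d%:E)%E.
  apply: le_lt_trans UN.
  have -> : mu U = (mu (U `&` N) + mu (U `\` N))%E.
    by rewrite addeC; exact: measureDI.
  rewrite (_ : mu (U `&` N) = 0)%E ?add0e//.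
  apply/eqP; rewrite eq_le measure_ge0 andbT -N0 le_measure ?inE//.
  exact: measurableI.
(* Intersecting with a bounded interval makes every component have end points; the
   bound [b + 1] keeps [b] inside, and clamping undoes the enlargement. *)
pose V := U `&` `]a, (b + 1)%R[%classic.
have oV : open V by apply: openI => //; exact: interval_open.
have [p [p12 np tp VE]] := bounded_open_intervals oV (@subIsetr _ _ _).
have mI k : measurable (`](p k).1, (p k).2[%classic : set R) by exact: measurable_itv.
apply: (@le_trans _ _ (lebesgue_stieltjes_measure G V)).
  apply: le_measure; rewrite ?inE.
  - by apply: measurableI => //; exact: measurable_itv.
  - exact: open_measurable.
  - move=> z [/NU Uz]; rewrite /= !in_itv/= => /andP[az zb]; split => //.
    by rewrite /= in_itv/= az (le_lt_trans zb)// ltrDl.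
rewrite VE measure_bigcup//.
apply: lime_le => [|].
  by apply: is_cvg_nneseries => k _ _; exact: measure_ge0.
apply: nearW => n.
pose s := [seq (clamp a b (p k).1, clamp a b (p k).2) | k <- iota 0 n].
apply: (@le_trans _ _ (total_increment g s)%:E).
  rewrite /total_increment big_map -sumEFin /index_iota subn0.
  under eq_bigl do rewrite in_setT.
  apply: lee_sum => k _ /=.
  apply: (@le_trans _ _ (lebesgue_stieltjes_measure G `](p k).1, (p k).2]%classic)).
    apply: le_measure; rewrite ?inE; [exact: measurable_itv..|].
    exact: subset_itv_oo_oc.
  by rewrite lebesgue_stieltjes_measure_oc// lee_fin GE/= ler_norm.
rewrite lee_fin; apply: H.
- apply/allP => _ /mapP[k _ ->] /=; have /andP[-> _] := clamp_itv (p k).1 ab.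
  by have /andP[_ ->] := clamp_itv (p k).2 ab; rewrite clamp_le.
- rewrite /nonoverlapping pairwise_map; apply: (@sub_pairwise _ ltn) => /=; last first.
    by have := iota_ltn_sorted 0 n; rewrite (sorted_pairwise ltn_trans).
  move=> i j /= ij; have /np/orP[h|h] : i != j by rewrite ltn_eqF.
    by rewrite clamp_le.
  by rewrite [X in _ || X]clamp_le// orbT.
- rewrite -lte_fin; apply: le_lt_trans Ud.
  apply: (@le_trans _ _ (mu V)); last first.
    by apply: le_measure; rewrite ?inE//; [exact: open_measurable|exact: subIsetl].
  rewrite VE measure_bigcup//.
  apply: (@le_trans _ _ (\sum_(0 <= k < n | k \in [set: nat])
      mu `](p k).1, (p k).2[%classic)%E); last first.
    by apply: nneseries_lim_ge => k _ _; exact: measure_ge0.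
  rewrite /total_length big_map -sumEFin /index_iota subn0.
  under [leRHS]eq_bigl do rewrite in_setT.
  apply: lee_sum => k _ /=; rewrite lebesgue_measure_itv/= lte_fin.
  case: ltP => h; first by rewrite -EFinB lee_fin clamp_dist.
  by rewrite (@le_anti _ _ (p k).1 (p k).2) ?subrr// p12 h.
Qed.
End densities.

Section ftc_ac.
Variable R : realType.
Local Notation mu := (@lebesgue_measure R).
Implicit Types (a b : R) (f g : R -> R).

Lemma nondecreasing_list_ac_density a b g : a <= b ->
  (forall x y, a <= x -> x <= y -> y <= b -> g x <= g y) -> list_ac a b g ->
  exists2 h : R -> R, mu.-integrable setT (EFin \o h) &
    forall x, a <= x -> x <= b -> (\int[mu]_(t in `[a, x]) h t = g x - g a)%R.
Proof.
move=> ab ndg ac; pose G := g \o clamp a b.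
have ndG : nondecreasing G.
  move=> x y xy; have /andP[ax _] := clamp_itv x ab.
  by have /andP[_ yb] := clamp_itv y ab; apply: ndg => //; exact: clamp_le.
have rcG : right_continuous G.
  exact/right_continuousW/list_ac_clamp_continuous.
pose Gc : cumulative R R := HB.pack G (isCumulative.Build _ _ _ G ndG rcG).
pose m := lebesgue_stieltjes_measure Gc.
have mD : measurable (`]a, b]%classic : set (measurableTypeR R)) by exact: measurable_itv.
have mDy : (m `]a, b]%classic < +oo)%E.
  by rewrite /m lebesgue_stieltjes_measure_oc// ltry.
pose nu := mfrestr mD mDy.
have numu : nu `<< mu.
  apply/null_content_dominatesP => N mN N0; exact: (stieltjes_null ab ac).
have [h [h0 hfin hint hE]] := radon_nikodym_sigma_finite numu.
exists (fine \o h) => [|x ax xb].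
  by apply: eq_integrable hint => // x _ /=; rewrite fineK.
rewrite /Rintegral.
under eq_integral do rewrite /= fineK//.
rewrite -hE; last exact: measurable_itv.
rewrite /nu /mfrestr /mrestr/=.
transitivity (fine (m `]a, x]%classic)); last first.
  by rewrite /m lebesgue_stieltjes_measure_oc//= /G/= !clamp_id.
congr (fine (m _)); apply/seteqP; split => t; rewrite /= !in_itv/=.
  by move=> [/andP[_ ->] /andP[-> _]].
by move=> /andP[at' tx]; rewrite (ltW at') tx at' (le_trans tx xb).
Qed.

Lemma list_ac_density a b f : a <= b -> list_ac a b f ->
  exists2 h : R -> R, mu.-integrable setT (EFin \o h) &
    forall x, a <= x -> x <= b -> (\int[mu]_(t in `[a, x]) h t = f x - f a)%R.
Proof.
move=> ab ac; pose T x := fine (total_variation a x f).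
have acT : list_ac a b T by exact: list_ac_fine_total_variation.
have [h1 ih1 Eh1] := nondecreasing_list_ac_density ab
  (fine_total_variation_nondecreasing ac) acT.
have [h2 ih2 Eh2] := nondecreasing_list_ac_density ab
  (fine_total_variationB_nondecreasing ac) (list_acB acT ac).
exists (fun x => h1 x - h2 x) => [|x ax xb].
  by rewrite (_ : EFin \o _ = (EFin \o h1) \- (EFin \o h2))%E//; exact: integrableB.
rewrite RintegralB; first by rewrite Eh1// Eh2//; rewrite /T; lra.
- exact: measurable_itv.
- by apply: integrableS ih1.
- by apply: integrableS ih2.
Qed.

(** Half of the fundamental theorem of calculus: the density [h] of [f] is, by the
Lebesgue differentiation theorem, almost everywhere the derivative of
[x |-> \int_a^x h = f x - f a]. *)
Lemma abs_continuous_increment_le a b f : a < b -> abs_continuous a b f ->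
  measurable_fun `]a, b[ (derive1 f) ->
  (`|f b - f a|%:E <= \int[mu]_(x in `]a, b[) `|derive1 f x|%:E)%E.
Proof.
move=> ab /abs_continuous_list_ac acf mf.
have [h ih Eh] := list_ac_density (ltW ab) acf.
have ihS (A : set R) : measurable A -> mu.-integrable A (EFin \o h).
  by move=> mA; apply: integrableS ih.
have mh : measurable_fun setT h by apply/measurable_EFinP; exact: measurable_int ih.
have lh : locally_integrable setT h.
  exact: (@open_integrable_locally R setT h openT ih).
have := FTC1 (a := BLeft a) (fun y => ihS _ (measurable_itv _)) lh.
set F := fun x => (\int[mu]_(t in `[a, x]) h t)%R => aeF.
rewrite -Eh ?lexx ?(ltW ab)//.
have -> : (`|\int[mu]_(t in `[a, b]) h t|%:E =
    `|\int[mu]_(t in `[a, b]) (h t)%:E|)%E.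
  by rewrite EFin_normr_Rintegral//; exact: ihS.
apply: le_trans (le_abse_integral _ _ _) _ => //.
  exact/measurable_EFinP/measurable_funTS.
rewrite /= -(@integral_itv_bndo_bndc _ (BLeft a)); last first.
  by apply/measurable_EFinP/measurableT_comp => //; exact: measurable_funTS.
rewrite -(@integral_itv_obnd_cbnd _ a); last first.
  by apply/measurable_EFinP/measurableT_comp => //; exact: measurable_funTS.
apply: ae_ge0_le_integral => //.
- by apply/measurable_EFinP/measurableT_comp => //; exact: measurable_funTS.
- by apply/measurable_EFinP/measurableT_comp.
case: aeF => N [mN N0 FN]; exists N; split => //.
apply: subset_trans FN; apply: subsetC => x /= Fx; rewrite in_itv/= => /andP[ax xb].
have [|dF F'x] := Fx; first by rewrite lte_fin.
rewrite -F'x lee_fin; suff -> : derive1 f x = derive1 F x by [].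
rewrite !derive1E.
rewrite (@near_eq_derive _ _ _ f (F \+ cst (f a)))%R.
  by rewrite deriveD// derive_cst addr0.
near=> y; rewrite /= /F Eh ?subrK//; apply: ltW; near: y.
- exact: lt_nbhsr.
- exact: lt_nbhsl.
Unshelve. all: by end_near. Qed.
End ftc_ac.

(** * The weights *)

Section weights.
Variable R : realType.
Local Notation mu := (@lebesgue_measure R).

(** The integrand is singular at [0]: exhaust [(0, r]] by the intervals [[r/n, r]],
on which [2 sqrt x] is a primitive. *)
Lemma integral_inv_sqrt_le (r : R) : 0 < r ->
  (\int[mu]_(x in `]0%R, r]) ((Num.sqrt x)^-1)%:E <= (2 * Num.sqrt r)%:E)%E.
Proof.
move=> r0.
pose F n := (`[r / n.+2%:R, r]%classic : set R).
have Fpos n x : F n x -> 0 < x.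
  by rewrite /F /= in_itv/= => /andP[h _]; apply: lt_le_trans h; rewrite divr_gt0.
have msq : measurable_fun (`]0, r]%classic : set R) (fun x : R => ((Num.sqrt x)^-1)%:E).
  apply/measurable_EFinP.
  apply: (@measurable_funS _ _ _ _ (`]0, +oo[%classic : set R)) => //.
    by move=> x; rewrite /= !in_itv/= => /andP[-> _].
  apply: open_continuous_measurable_fun; first exact: interval_open.
  move=> x; rewrite inE/= in_itv/= andbT => x0.
  by apply: continuousV; [rewrite gt_eqF// sqrtr_gt0|exact: sqrt_continuous].
have FU : `]0, r]%classic = \bigcup_n F n.
  apply/seteqP; split => x.
    rewrite /= in_itv/= => /andP[x0 xr].
    exists (Num.bound `|r / x|) => //; rewrite /F /= in_itv/= xr andbT.
    rewrite ler_pdivrMr// mulrC -ler_pdivrMr//.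
    apply/ltW/(le_lt_trans (ler_norm _)).
    by apply: lt_trans (archi_boundP (normr_ge0 _)) _; rewrite ltr_nat.
  move=> [n _] Fx; have := Fpos _ _ Fx; move: Fx.
  by rewrite /F/= !in_itv/= => /andP[_ ->] ->.
have FS n : F n `<=` `]0, r].
  by rewrite FU; exact: bigcup_sup.
rewrite FU; set I := (X in (X <= _)%E).
have cv : (\int[mu]_(x in F n) ((Num.sqrt x)^-1)%:E @[n --> \oo] --> I)%E.
  apply: ge0_nondecreasing_set_cvg_integral.
  - move=> m n mn; apply/subsetPset => x; rewrite /F/= !in_itv/= => /andP[h ->].
    rewrite andbT (le_trans _ h)// ler_pM2l// lef_pV2 ?posrE// ler_nat.
    by rewrite !ltnS.
  - by move=> n; exact: measurable_itv.
  - by move=> n; exact: measurable_funS msq.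
  - by move=> n x _; rewrite lee_fin invr_ge0 sqrtr_ge0.
rewrite -(cvg_lim _ cv)//; apply: lime_le; first by apply/cvg_ex; exists I.
apply: nearW => n.
have rn : r / n.+2%:R < r by rewrite ltr_pdivrMr// ltr_pMr// ltr1n.
have rn0 : 0 < r / n.+2%:R by rewrite divr_gt0.
rewrite /F (@continuous_FTC2 _ _ (fun x => 2 * Num.sqrt x))//.
- by rewrite -EFinB lee_fin lerBlDr lerDl mulr_ge0// sqrtr_ge0.
- apply: continuous_in_subspaceT => x /set_mem/Fpos x0.
  by apply: continuousV; [rewrite gt_eqF// sqrtr_gt0|exact: sqrt_continuous].
- split.
  + move=> x; rewrite in_itv/= => /andP[/(lt_trans rn0) x0 _].
    by apply: derivableM; [exact: derivable_cst|case: (is_derive1_sqrt x0)].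
  + by apply: cvg_at_right_filter; apply: cvgM; [exact: cvg_cst|exact: sqrt_continuous].
  + by apply: cvg_at_left_filter; apply: cvgM; [exact: cvg_cst|exact: sqrt_continuous].
- move=> x; rewrite in_itv/= => /andP[/(lt_trans rn0) x0 _].
  rewrite derive1E deriveZ/=; last by case: (is_derive1_sqrt x0).
  rewrite derive_sqrt// invfM -[LHS]/(2 * (2^-1 * (Num.sqrt x)^-1)).
  by rewrite mulrA divff// mul1r.
Qed.

Lemma measurable_Gamma_integrand (s : R) (A : set R) :
  measurable_fun A (fun t : R => t `^ (s - 1) * expR (- t)).
Proof.
apply: (measurable_funS measurableT) => //.
by apply: measurable_funM; [exact: measurable_powR|exact: measurableT_comp].
Qed.

(** For [s >= 1/2] the integrand is at most [1 / sqrt t] on [(0, 1]]. *)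
Lemma Gamma_integral_head (s : R) : 2^-1 <= s ->
  (\int[mu]_(t in `]0%R, 1%R]) (t `^ (s - 1) * expR (- t))%:E < +oo)%E.
Proof.
move=> s2; apply: le_lt_trans (_ : ((2 * Num.sqrt 1)%:E < +oo)%E); last exact: ltry.
apply: le_trans (integral_inv_sqrt_le ltr01).
apply: ge0_le_integral => //.
- by move=> t _; rewrite lee_fin mulr_ge0// ?powR_ge0// expR_ge0.
- by apply/measurable_EFinP; exact: measurable_Gamma_integrand.
- apply/measurable_EFinP.
  apply: (@measurable_funS _ _ _ _ (`]0, +oo[%classic : set R)) => //.
    by move=> x; rewrite /= !in_itv/= => /andP[-> _].
  apply: open_continuous_measurable_fun; first exact: interval_open.
  move=> x; rewrite inE/= in_itv/= andbT => x0.
  by apply: continuousV; [rewrite gt_eqF// sqrtr_gt0|exact: sqrt_continuous].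
- move=> t; rewrite /= in_itv/= => /andP[t0 t1].
  rewrite lee_fin -powR12_sqrt ?(ltW t0)// -powRN.
  rewrite -[leRHS]mulr1; apply: ler_pM; rewrite ?powR_ge0 ?expR_ge0//.
    by apply: ger_powR; [rewrite t0|lra].
  by rewrite -expR0 ler_expR oppr_le0 ltW.
Qed.

(** The power is at most [K exp (t / 2)], by one term of the exponential series,
so that the integrand is dominated by an exponential density. *)
Lemma Gamma_integral_tail (s : R) :
  (\int[mu]_(t in `]1%R, +oo[) (t `^ (s - 1) * expR (- t))%:E < +oo)%E.
Proof.
have [n sn] : exists n : nat, s - 1 <= n.+1%:R.
  exists (Num.bound `|s|); have := archi_boundP (normr_ge0 s).
  by have := ler_norm s; rewrite -natr1; lra.
pose K : R := 2 ^+ n.+1 * n.+1`!%:R; pose C := 2 * K.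
have K0 : 0 < K by rewrite mulr_gt0 ?exprn_gt0// ltr0n fact_gt0.
have C0 : 0 <= C by rewrite mulr_ge0// ltW.
apply: (@le_lt_trans _ _ (\int[mu]_(t in setT) (C%:E * (exponential_pdf 2^-1 t)%:E))%E).
  have mpdf : measurable_fun setT (fun t => C%:E * (exponential_pdf 2^-1 t)%:E)%E.
    by apply/measurable_EFinP; apply: measurable_funM => //;
      exact: measurable_exponential_pdf.
  have pdf0 t : (0 <= C%:E * (exponential_pdf 2^-1 t)%:E)%E.
    by rewrite mule_ge0// lee_fin// exponential_pdf_ge0.
  apply: (@le_trans _ _ (\int[mu]_(t in `]1%R, +oo[)
      (C%:E * (exponential_pdf 2^-1 t)%:E))%E); last exact: ge0_subset_integral.
  apply: ge0_le_integral => //.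
  - by move=> t _; rewrite lee_fin mulr_ge0// ?powR_ge0// expR_ge0.
  - by apply/measurable_EFinP; exact: measurable_Gamma_integrand.
  - exact: measurable_funTS.
  - move=> t; rewrite /= in_itv/= andbT => t1.
    have t0 : 0 <= t by rewrite (le_trans ler01)// ltW.
    rewrite -EFinM lee_fin exponential_pdfE//.
    have h1 : t `^ (s - 1) <= t ^+ n.+1.
      rewrite -powR_mulrn//; by apply: ler_powR => //; exact: ltW.
    have h2 : t ^+ n.+1 <= K * expR (2^-1 * t).
      rewrite -ler_pdivrMl//.
      have t20 : 0 <= 2^-1 * t by rewrite mulr_ge0// invr_ge0.
      apply: le_trans (expR_ge1Dxn n t20).
      by rewrite exprMn exprVn invfM mulrAC ler_wpDl.
    apply: (@le_trans _ _ (K * expR (2^-1 * t) * expR (- t))).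
      by apply: ler_wpM2r; [exact: expR_ge0|exact: le_trans h1 h2].
    rewrite -mulrA -expRD [2^-1 * t - t](_ : _ = - 2^-1 * t); last by lra.
    by rewrite /C; lra.
rewrite ge0_integralZl//.
- by rewrite integral_exponential_pdf// mule1 ltry.
- by apply/measurable_EFinP; exact: measurable_exponential_pdf.
- by move=> t _; rewrite lee_fin exponential_pdf_ge0.
Qed.

(** [Gamma] is extracted from an extended real integral by a function that sends
[+oo] to [0], so its positivity includes the convergence of the integral. *)
Lemma Gamma_gt0 (s : R) : 2^-1 <= s -> 0 < Gamma s.
Proof.
move=> s2; rewrite /Gamma /Rintegral.
have f0 t : (0 <= (t `^ (s - 1) * expR (- t))%:E)%E.
  by rewrite lee_fin mulr_ge0// ?powR_ge0// expR_ge0.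
have mf (A : set R) : measurable_fun A (fun t => (t `^ (s - 1) * expR (- t))%:E).
  by apply/measurable_EFinP; exact: measurable_Gamma_integrand.
apply: fine_gt0; apply/andP; split.
  apply: (@lt_le_trans _ _ (\int[mu]_(t in `[1%R, 2%R]) (cst (2^-1 * expR (-2))%:E t))%E).
    rewrite integral_cst//= lebesgue_measure_itv/= lte_fin ltr1n -EFinB -EFinM.
    by rewrite lte_fin !mulr_gt0 ?invr_gt0 ?expR_gt0// subr_gt0 ltr1n.
  have sub : `[1%R, 2%R] `<=` (`]0%R, +oo[ : set R).
    by move=> t; rewrite /= !in_itv/= andbT => /andP[/(lt_le_trans ltr01)].
  apply: (@le_trans _ _ (\int[mu]_(t in `[1%R, 2%R])
      (t `^ (s - 1) * expR (- t))%:E)%E); last first.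
    by apply: ge0_subset_integral => //; exact: mf.
  apply: ge0_le_integral => //.
    by move=> t _; rewrite lee_fin mulr_ge0// ?expR_ge0// invr_ge0.
    exact: mf.
  move=> t; rewrite /= in_itv/= => /andP[t1 t2].
  have t0 : 0 < t by rewrite (lt_le_trans ltr01).
  rewrite lee_fin; apply: ler_pM; rewrite ?invr_ge0 ?expR_ge0//.
    apply: (@le_trans _ _ (t `^ (-1))); last by apply: ler_powR => //; lra.
    by rewrite powR_inv1 ?(ltW t0)// lef_pV2 ?posrE.
  by rewrite ler_expR lerN2.
rewrite (@itv_bndbnd_setU _ _ _ (BRight 1))//; last by rewrite bnd_simp.
rewrite ge0_integral_setU//.
- by rewrite lte_add_pinfty// ?Gamma_integral_head// Gamma_integral_tail.
- exact: mf.
- apply/disj_setPLR => t /=; rewrite !in_itv/= andbT => /andP[_ t1].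
  by apply/negP; rewrite -leNgt.
Qed.

Lemma omega_gt0 (beta : R) : 0 <= beta -> 0 < omega beta.
Proof.
move=> b0; rewrite /omega divr_gt0 ?mulr_gt0 ?powR_gt0 ?pi_gt0// Gamma_gt0//; lra.
Qed.
End weights.

(** * Logarithmic bound on the increments *)

Section increments.
Variable R : realType.
Local Notation mu := (@lebesgue_measure R).

(** Optimising a weighted mean over [e]; for [A > 0] the choice [e = D / A] gives the
result without square roots. *)
Lemma sqr_le_of_weighted_means (A L D : R) : 0 <= A -> 0 < L -> 0 <= D ->
  (forall e, 0 < e -> D <= (e * A + L / e) / 2) -> D ^+ 2 <= A * L.
Proof.
move=> A0 L0; rewrite le_eqVlt => /predU1P[<- _|D0 H].
  by rewrite expr0n/= mulr_ge0// ltW.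
move: A0; rewrite le_eqVlt => /predU1P[A0|A0].
  have := H (L / D) (divr_gt0 L0 D0); rewrite -A0 mulr0 add0r invf_div mulrCA.
  by rewrite divff ?mulr1 ?gt_eqF//; lra.
have := H (D / A) (divr_gt0 D0 A0); rewrite divfK ?gt_eqF// invf_div.
rewrite ler_pdivlMr// mulr_natr mulr2n lerD2l mulrA ler_pdivlMr//.
by rewrite expr2 [A * L]mulrC.
Qed.

Lemma integral_inv (x y : R) : 0 < x -> x < y ->
  (\int[mu]_(t in `[x, y]) (t^-1)%:E = (ln y - ln x)%:E)%E.
Proof.
move=> x0 xy; rewrite (@continuous_FTC2 _ _ (@ln R))//.
- apply: continuous_in_subspaceT => t; rewrite inE/= in_itv/= => /andP[xt _].
  by apply: continuousV; [rewrite gt_eqF// (lt_le_trans x0)|exact: cvg_id].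
- split.
  + move=> t; rewrite in_itv/= => /andP[/(lt_trans x0) t0 _].
    by case: (is_derive1_ln t0).
  + by apply: cvg_at_right_filter; exact: continuous_ln.
  + by apply: cvg_at_left_filter; apply: continuous_ln; exact: lt_trans xy.
- move=> t; rewrite in_itv/= => /andP[/(lt_trans x0) t0 _].
  by rewrite derive1E; case: (is_derive1_ln t0) => _ ->.
Qed.

(** The Cauchy-Schwarz inequality for [|u'| = (|u'| sqrt t) (1 / sqrt t)], the integral
of [1 / t] over [(x, y)] being [ln y - ln x].  It is obtained from the pointwise
inequality [|u'| <= (e |u'|^2 t + 1 / (e t)) / 2] by optimising [e]. *)
Lemma increment_sqr_le (u : R -> R) (A : R) : loc_abs_continuous u ->
  measurable_fun (`]0, +oo[ : set R) (derive1 u) ->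
  lambda_int 1 (fun x => `|derive1 u x| ^+ 2) = A%:E ->
  forall x y : R, 0 < x -> x < y ->
    (u y - u x) ^+ 2 <= A / omega 1 * (ln y - ln x).
Proof.
move=> acu mdu EA x y x0 xy.
have w0 : 0 < omega (1 : R) by exact: omega_gt0.
have y0 : 0 < y := lt_trans x0 xy.
have sub : `]x, y[ `<=` (`]0, +oo[ : set R).
  by move=> t; rewrite /= !in_itv/= andbT => /andP[/(lt_trans x0)].
pose f t := `|derive1 u t| ^+ 2 * (omega 1 * t `^ 1).
have mduxy : measurable_fun (`]x, y[ : set R) (derive1 u).
  by apply: measurable_funS mdu => //; exact: measurable_itv.
have mf : measurable_fun (`]0, +oo[ : set R) (EFin \o f).
  apply/measurable_EFinP; apply: measurable_funM.
    by apply: measurable_funX; exact: measurableT_comp.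
  by apply: measurable_funM => //; apply: measurable_funTS; exact: measurable_powR.
have f0 t : 0 <= f t by rewrite mulr_ge0 ?exprn_ge0// mulr_ge0 ?powR_ge0// ltW.
have A0 : 0 <= A.
  by rewrite -lee_fin -EA; apply: integral_ge0 => t _; rewrite lee_fin f0.
have Lxy : 0 < ln y - ln x by rewrite subr_gt0 ltr_ln.
rewrite -real_normK ?num_real//; apply: sqr_le_of_weighted_means => //.
  by rewrite divr_ge0// ltW.
move=> e e0; rewrite -lee_fin.
apply: le_trans (abs_continuous_increment_le xy (acu _ _ x0 xy) mduxy) _.
pose c1 := e / (2 * omega 1); pose c2 := (2 * e)^-1.
have c10 : 0 <= c1 by apply: divr_ge0; [exact: ltW|apply: mulr_ge0 => //; exact: ltW].
have c20 : 0 <= c2 by rewrite invr_ge0 mulr_ge0// ltW.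
have minv0 : measurable_fun (`]0, +oo[ : set R) (fun t : R => (t^-1)%:E).
  apply/measurable_EFinP; apply: open_continuous_measurable_fun.
    exact: interval_open.
  move=> t /set_mem; rewrite /= in_itv/= andbT => t0.
  by apply: continuousV; [rewrite gt_eqF|exact: cvg_id].
have minv : measurable_fun (`]x, y[ : set R) (fun t : R => (t^-1)%:E).
  by apply: measurable_funS minv0 => //; exact: measurable_itv.
have invge t : `]x, y[%classic t -> (0 <= (t^-1)%:E)%E.
  by move=> /sub; rewrite /= in_itv/= andbT => t0; rewrite lee_fin invr_ge0 ltW.
have mfxy : measurable_fun (`]x, y[ : set R) (EFin \o f).
  by apply: measurable_funS mf => //; exact: measurable_itv.
apply: (@le_trans _ _ (\int[mu]_(t in `]x, y[)
    (c1%:E * (EFin \o f) t + c2%:E * (t^-1)%:E))%E).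
  apply: ge0_le_integral => //.
  - by apply/measurable_EFinP; exact: measurableT_comp.
  - by apply: emeasurable_funD; apply: emeasurable_funM.
  - move=> t /sub; rewrite /= in_itv/= andbT => t0.
    rewrite -!EFinM -EFinD lee_fin /f powRr1 ?(ltW t0)//.
    set z := `|_|; rewrite /c1 /c2.
    have -> : e / (2 * omega 1) * (z ^+ 2 * (omega 1 * t)) + (2 * e)^-1 * t^-1
        = z + (e * t * z - 1) ^+ 2 / (2 * e * t).
      by field; rewrite !gt_eqF.
    by rewrite lerDl divr_ge0 ?sqr_ge0// !mulr_ge0// ltW.
rewrite ge0_integralD//; first last.
- exact: emeasurable_funM.
- by move=> t xyt; rewrite mule_ge0//; exact: invge.
- exact: emeasurable_funM.
- by move=> t _; rewrite mule_ge0// lee_fin f0.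
rewrite !ge0_integralZl//.
have -> : (\int[mu]_(t in `]x, y[) (t^-1)%:E = (ln y - ln x)%:E)%E.
  rewrite -integral_inv// -(@integral_itv_bndo_bndc _ (BLeft x)).
    by rewrite -(@integral_itv_obnd_cbnd _ x).
  apply: measurable_funS minv0; first exact: measurable_itv.
  by move=> t; rewrite /= !in_itv/= andbT => /andP[/(lt_le_trans x0)].
apply: (@le_trans _ _ (c1%:E * A%:E + c2%:E * (ln y - ln x)%:E)%E).
  rewrite leeD2r// lee_wpmul2l//; rewrite -EA.
  by apply: ge0_subset_integral => // t _; rewrite lee_fin f0.
rewrite -!EFinM -EFinD lee_fin /c1 /c2 le_eqVlt; apply/orP; left; apply/eqP.
by field; rewrite !gt_eqF.
by move=> t _; rewrite lee_fin f0.
Qed.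
End increments.

(** * The exponential inequality *)

Section exponential_integrability.
Variable R : realType.

(** A majorant of the remainder [exp t - 1 - t] for which the gain of a factor
[s^2] under [t |-> s t] is immediate ([sqr_expM_le]). *)
Definition sqr_exp (t : R) := t ^+ 2 * expR t.

Lemma sqr_exp_ge0 t : 0 <= sqr_exp t.
Proof. by rewrite mulr_ge0 ?sqr_ge0// expR_ge0. Qed.

Lemma expR_sub1_le (t : R) : expR t - 1 <= t * expR t.
Proof.
have := expR_ge1Dx (- t); rewrite -(ler_pM2r (expR_gt0 t)) expRN.
by rewrite mulVf ?gt_eqF ?expR_gt0//; lra.
Qed.

Lemma expR_remainder_le (t : R) : 0 <= t -> expR t - 1 - t <= sqr_exp t.
Proof.
move=> t0; apply: (@le_trans _ _ (t * (expR t - 1))).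
  by have := expR_sub1_le t; lra.
by rewrite /sqr_exp expr2 -mulrA ler_wpM2l// expR_sub1_le.
Qed.

Lemma sqr_exp_le_id (t : R) : 0 <= t -> t <= 2^-1 -> sqr_exp t <= t.
Proof.
move=> t0 t2; have e0 := expR_gt0 t; have H := expR_sub1_le t.
have e2 : expR t <= 2.
  have : t * expR t <= 2^-1 * expR t by rewrite ler_wpM2r ?(ltW e0).
  by lra.
rewrite /sqr_exp expr2 -mulrA -[leRHS]mulr1 ler_wpM2l//.
have := ler_pM t0 (ltW e0) t2 e2; lra.
Qed.

(** Absorbs the square into a second exponential, at the price of doubling the
exponent. *)
Lemma sqr_exp_le_expR (t : R) : 0 <= t -> sqr_exp t <= 2 * expR (2 * t).
Proof.
move=> t0; rewrite [2 * t]mulr_natl mulr2n expRD mulrA /sqr_exp.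
rewrite ler_wpM2r ?expR_ge0//.
by have := expR_ge1Dxn 1 t0; rewrite !factS fact0 !muln1; lra.
Qed.

Lemma sqr_expM_le (s t : R) : 0 <= s -> s <= 1 -> 0 <= t ->
  sqr_exp (s * t) <= s ^+ 2 * sqr_exp t.
Proof.
move=> s0 s1 t0; rewrite /sqr_exp exprMn -mulrA ler_wpM2l ?sqr_ge0//.
by rewrite ler_wpM2l ?sqr_ge0// ler_expR ler_piMl.
Qed.

(** Any point of the set where [|v| >= 1] that exceeds half of its supremum. *)
Lemma last_large_value (v : R -> R) : v x @[x --> +oo] --> (0 : R) ->
  (exists2 x, 0 < x & 1 <= `|v x|) ->
  exists x0, [/\ 0 < x0, 1 <= `|v x0| & forall x, 2 * x0 <= x -> `|v x| < 1].
Proof.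
move=> v0 [z z0 vz].
have [M [Mreal HM]] : \forall x \near +oo, `|v x| < 1.
  by near=> x; rewrite -[v x]subr0 distrC; near: x; exact: cvgr_dist_lt.
pose S := [set x : R | 0 < x /\ 1 <= `|v x|].
have Sz : S z by [].
have ubS : ubound S M.
  by move=> x [x0 vx]; rewrite leNgt; apply/negP => /HM; rewrite ltNge vx.
have hS : has_sup S by split; [exists z|exists M].
have s0 : 0 < sup S.
  by apply: lt_le_trans (ub_le_sup (ex_intro _ M ubS) Sz).
have [x0 [x00 vx0] hx0] := sup_adherent (divr_gt0 s0 (ltr0Sn _ 1)) hS.
exists x0; split => // x xx0; rewrite ltNge; apply/negP => vx.
have Sx : S x by split => //; lra.
by have := ub_le_sup (ex_intro _ M ubS) Sx; lra.
Unshelve. all: by end_near. Qed.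

(** With [c <= 1/2] the inequality [sqr_exp (c v^2) <= v^2] holds wherever
[|v| < 1]; with [c <= 1 / (8 k)] a squared increment [k ln (r / x)] of [v] makes
[exp (2 c v^2)] grow at most like [sqrt (r / x)]. *)
Definition embedding_exponent (k : R) := Num.min 2^-1 (8 * k)^-1.

(** The ratio of the upper bound [4 e^2 omega r^(theta + 1)] for the remainder on
[(0, r]], where [r = 2 x0], to the lower bound
[omega (d x0)^theta (1 - d) x0 / 4] for the integral of [v^2], plus [1] for the
part where [|v| < 1].  The fraction [d] is such that [k ln (1 / d) = 1 / 4]. *)
Definition embedding_constant (theta k : R) :=
  let d := expR (- (4 * k)^-1) in
  1 + 32 * expR 2 / ((d / 2) `^ theta * (1 - d)).

(** With [r = 2 x0] and [L = ln r - ln x], the bound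
[v x^2 <= 2 (v r)^2 + 2 (v r - v x)^2 <= 2 + 2 k L] turns the exponential into a
power of [r / x]. *)
Lemma sqr_exp_bound (k x0 : R) (v : R -> R) : 0 < k -> 0 < x0 ->
  (forall x y, 0 < x -> x < y -> (v y - v x) ^+ 2 <= k * (ln y - ln x)) ->
  (forall x, 2 * x0 <= x -> `|v x| < 1) ->
  forall x, 0 < x -> x <= 2 * x0 ->
  sqr_exp (embedding_exponent k * v x ^+ 2) <=
    2 * expR 2 * Num.sqrt (2 * x0) * (Num.sqrt x)^-1.
Proof.
move=> k0 x00 H v1 x xpos xx0; set c := embedding_exponent k.
have r0 : 0 < 2 * x0 by rewrite mulr_gt0.
have c0 : 0 < c by rewrite lt_min !invr_gt0 mulr_gt0// ltr0n.
have c2 : c <= 2^-1 by rewrite ge_min lexx.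
have ck : c * k <= 8^-1.
  have h : c <= (8 * k)^-1 by rewrite ge_min lexx orbT.
  by rewrite -ler_pdivlMr// -invfM.
apply: le_trans (sqr_exp_le_expR _) _.
  by rewrite mulr_ge0 ?sqr_ge0// ltW.
have L0 : 0 <= ln (2 * x0) - ln x by rewrite subr_ge0 ler_ln.
set L := ln (2 * x0) - ln x in L0.
have vx : v x ^+ 2 <= 2 + 2 * k * L.
  have := v1 _ (lexx _); rewrite -(@ltr_pXn2r _ 2) ?nnegrE// real_normK ?num_real// expr1n => v1'.
  have {}H : (v (2 * x0) - v x) ^+ 2 <= k * L.
    move: xx0; rewrite le_eqVlt => /predU1P[xE|]; last exact: H.
    by rewrite /L xE !subrr expr0n/= mulr0.
  have : 0 <= (2 * v (2 * x0) - v x) ^+ 2 by exact: sqr_ge0.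
  by nra.
have e1 : 2 * (c * v x ^+ 2) <= 2 + 2^-1 * L.
  have h1 : c * v x ^+ 2 <= c * (2 + 2 * k * L) by rewrite ler_wpM2l// ltW.
  have h2 : c * k * L <= 8^-1 * L by rewrite ler_wpM2r.
  by nra.
have -> : (Num.sqrt x)^-1 = expR (- (2^-1 * ln x)).
  by rewrite expRN -ln_powR lnK ?posrE ?powR_gt0// powR12_sqrt// ltW.
have -> : Num.sqrt (2 * x0) = expR (2^-1 * ln (2 * x0)).
  by rewrite -ln_powR lnK ?posrE ?powR_gt0// powR12_sqrt// ltW.
rewrite -!mulrA ler_wpM2l// -!expRD ler_expR.
by apply: le_trans e1 _; rewrite /L; lra.
Qed.
End exponential_integrability.

Section embedding.
Variable R : realType.
Local Notation mu := (@lebesgue_measure R).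

Lemma measurable_weighted (theta : R) (A : set R) (f : R -> R) :
  measurable_fun A f ->
  measurable_fun A (fun x => (f x * (omega theta * x `^ theta))%:E).
Proof.
move=> mf; apply/measurable_EFinP; apply: measurable_funM => //.
apply: (measurable_funS measurableT) => //.
by apply: measurable_funM => //; exact: measurable_powR.
Qed.

Lemma weight_ge0 (theta : R) (x : R) : 0 <= theta -> 0 <= omega theta * x `^ theta.
Proof. by move=> t0; rewrite mulr_ge0 ?powR_ge0// ltW// omega_gt0. Qed.

Lemma lambda_int_ge0 (theta : R) (f : R -> R) : 0 <= theta ->
  (forall x, 0 <= f x) -> (0 <= lambda_int theta f)%E.
Proof.
by move=> t0 f0; apply: integral_ge0 => x _; rewrite lee_fin mulr_ge0// weight_ge0.
Qed.

(** On [(d x0, x0)] the increment [v x0 - v x] is at most [1/2] in absolute value,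
hence [|v| >= 1/2] there. *)
Lemma lambda_int_lower_bound (theta k x0 d : R) (v : R -> R) : 0 <= theta ->
  0 < k -> 0 < x0 -> measurable_fun (`]0, +oo[ : set R) v ->
  (forall x y, 0 < x -> x < y -> (v y - v x) ^+ 2 <= k * (ln y - ln x)) ->
  1 <= `|v x0| -> d = expR (- (4 * k)^-1) ->
  ((4^-1 * omega theta * (d * x0) `^ theta * ((1 - d) * x0))%:E <=
   lambda_int theta (fun x => v x ^+ 2)%R)%E.
Proof.
move=> t0 k0 x00 mv H vx0 dE.
have d0 : 0 < d by rewrite dE expR_gt0.
have d1 : d < 1 by rewrite dE -expR0 ltr_expR oppr_lt0 invr_gt0 mulr_gt0.
have dx : d * x0 < x0 by rewrite gtr_pMl.
have dx0 : 0 < d * x0 by rewrite mulr_gt0.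
have sub : `]d * x0, x0[ `<=` (`]0, +oo[ : set R).
  by move=> x; rewrite /= !in_itv/= andbT => /andP[/(lt_trans dx0)].
have mf : measurable_fun (`]0, +oo[ : set R) (fun x => v x ^+ 2).
  exact: measurable_funX.
have w0 := omega_gt0 t0.
apply: (@le_trans _ _ (\int[mu]_(x in `](d * x0)%R, x0[)
    (v x ^+ 2 * (omega theta * x `^ theta))%:E)%E); last first.
  apply: ge0_subset_integral => //; first exact: measurable_weighted.
  by move=> x _; rewrite lee_fin mulr_ge0 ?sqr_ge0 ?weight_ge0.
apply: (@le_trans _ _ (\int[mu]_(x in `](d * x0)%R, x0[)
    (cst (4^-1 * omega theta * (d * x0) `^ theta)%:E x))%E).
  rewrite integral_cst//= lebesgue_measure_itv/= lte_fin dx -EFinB -EFinM.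
  by rewrite lee_fin mulrBl mul1r.
apply: ge0_le_integral => //.
- by move=> x _; rewrite lee_fin mulr_ge0 ?powR_ge0// mulr_ge0 ?invr_ge0// ltW.
- apply: measurable_weighted; apply: measurable_funS mf => //; exact: measurable_itv.
- move=> x; rewrite /= in_itv/= => /andP[dxx xx0].
  have xpos : 0 < x := lt_trans dx0 dxx.
  rewrite lee_fin -mulrA; apply: ler_pM => //.
  - by rewrite mulr_ge0 ?powR_ge0// ltW.
  - have : (v x0 - v x) ^+ 2 <= 4^-1.
      apply: le_trans (H _ _ xpos xx0) _.
      have : ln (d * x0) < ln x by rewrite ltr_ln.
      rewrite lnM ?posrE// dE expRK => h.
      have : k * (ln x0 - ln x) <= k * (4 * k)^-1 by rewrite ler_pM2l//; lra.
      by rewrite invfM mulrCA divff ?mulr1 ?gt_eqF.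
    have : 1 <= v x0 ^+ 2.
      by rewrite -real_normK ?num_real// -[leLHS](expr1n _ 2) ler_pXn2r ?nnegrE.
    move=> h1 h2.
    have := sqr_ge0 (v x0 - 2 * (v x0 - v x)).
    nra.
  - by rewrite ler_pM2l//; apply: ge0_ler_powR => //; rewrite ?nnegrE; exact: ltW.
Qed.

(** A scale invariant exponential inequality: both sides scale alike under
[x |-> s x], and so does the hypothesis on the increments.  This is why the
constant does not depend on the point [x0] that separates the two regimes. *)
Lemma sqr_exp_integral_le (theta k : R) (v : R -> R) : 0 <= theta -> 0 < k ->
  measurable_fun (`]0, +oo[ : set R) v ->
  (forall x y, 0 < x -> x < y -> (v y - v x) ^+ 2 <= k * (ln y - ln x)) ->
  v x @[x --> +oo] --> (0 : R) ->
  (lambda_int theta (fun x => sqr_exp (embedding_exponent k * v x ^+ 2)) <=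
   (embedding_constant theta k)%:E * lambda_int theta (fun x => v x ^+ 2)%R)%E.
Proof.
move=> t0 k0 mv H v0; set c := embedding_exponent k.
have c0 : 0 < c by rewrite lt_min !invr_gt0 mulr_gt0// ltr0n.
have c2 : c <= 2^-1 by rewrite ge_min lexx.
have w0 := omega_gt0 t0.
pose f x := sqr_exp (c * v x ^+ 2).
have mv2 : measurable_fun (`]0, +oo[ : set R) (fun x => v x ^+ 2).
  exact: measurable_funX.
have mf : measurable_fun (`]0, +oo[ : set R) f.
  apply: measurable_funM.
    by apply: measurable_funX; exact: measurable_funM.
  by apply: measurableT_comp => //; exact: measurable_funM.
have fge0 x : 0 <= f x * (omega theta * x `^ theta).
  by rewrite mulr_ge0 ?sqr_exp_ge0 ?weight_ge0.
have vge0 x : 0 <= v x ^+ 2 * (omega theta * x `^ theta).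
  by rewrite mulr_ge0 ?sqr_ge0 ?weight_ge0.
have Iv0 : (0 <= lambda_int theta (fun x => v x ^+ 2)%R)%E.
  by apply: lambda_int_ge0 => // x; exact: sqr_ge0.
have small x : `|v x| < 1 -> f x <= v x ^+ 2.
  rewrite -(@ltr_pXn2r _ 2) ?nnegrE// real_normK ?num_real// expr1n => v1.
  have h : c * v x ^+ 2 <= v x ^+ 2.
    by rewrite ler_piMl ?sqr_ge0//; lra.
  apply: le_trans h; apply: sqr_exp_le_id; first by rewrite mulr_ge0 ?sqr_ge0// ltW.
  have := ler_pM (ltW c0) (sqr_ge0 (v x)) c2 (ltW v1); lra.
set d := expR (- (4 * k)^-1).
have d0 : 0 < d := expR_gt0 _.
have d1 : d < 1 by rewrite -expR0 ltr_expR oppr_lt0 invr_gt0 mulr_gt0.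
pose C1 := 32 * expR 2 / ((d / 2) `^ theta * (1 - d)).
have C10 : 0 < C1.
  rewrite divr_gt0 ?mulr_gt0 ?expR_gt0 ?powR_gt0 ?divr_gt0 ?subr_gt0//.
have CE : embedding_constant theta k = 1 + C1 by [].
have C1E : (0 <= embedding_constant theta k)%R by rewrite CE addr_ge0// ltW.
have [[z z0 vz]|nov] := pselect (exists2 x, 0 < x & 1 <= `|v x|); last first.
  apply: (@le_trans _ _ (lambda_int theta (fun x => v x ^+ 2))); last first.
    rewrite -[leLHS]mul1e lee_wpmul2r// lee_fin CE; lra.
  apply: ge0_le_integral => //.
  - by move=> x _; rewrite lee_fin fge0.
  - exact: measurable_weighted.
  - exact: measurable_weighted.
  - move=> x; rewrite /= in_itv/= andbT => x0.
    rewrite lee_fin ler_wpM2r ?weight_ge0//; apply: small.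
    by rewrite ltNge; apply/negP => h; apply: nov; exists x.
have [x0 [x00 vx0 v1]] := last_large_value v0 (ex_intro2 _ _ z z0 vz).
set r := 2 * x0 in v1.
have r0 : 0 < r by rewrite mulr_gt0.
have rsub : `]0, r] `<=` (`]0, +oo[ : set R).
  by move=> x; rewrite /= !in_itv/= andbT => /andP[].
have ysub : `]r, +oo[ `<=` (`]0, +oo[ : set R).
  by move=> x; rewrite /= !in_itv/= !andbT; exact: lt_trans.
rewrite {1}/lambda_int (@itv_bndbnd_setU _ _ _ (BRight r))//; last first.
  by rewrite bnd_simp ltW.
have U : `]0, r]%classic `|` `]r, +oo[%classic = (`]0, +oo[%classic : set R).
  by rewrite -itv_bndbnd_setU// bnd_simp ltW.
rewrite ge0_integral_setU//; last 3 first.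
- by rewrite U; exact: measurable_weighted.
- by move=> x _; rewrite lee_fin fge0.
- apply/disj_setPLR => x /=; rewrite !in_itv/= andbT => /andP[_ xr].
  by apply/negP; rewrite -leNgt.
rewrite CE EFinD ge0_muleDl ?lee_fin ?(ltW C10)// mul1e [leRHS]addeC.
apply: leeD; last first.
  apply: (@le_trans _ _ (\int[mu]_(x in `]r, +oo[)
      (v x ^+ 2 * (omega theta * x `^ theta))%:E)%E); last first.
    apply: ge0_subset_integral => //.
    + exact: measurable_weighted.
    + by move=> x _; rewrite lee_fin vge0.
  apply: ge0_le_integral => //.
  - by move=> x _; rewrite lee_fin fge0.
  - apply: measurable_weighted; apply: measurable_funS mf => //; exact: measurable_itv.
  - apply: measurable_weighted; apply: measurable_funS mv2 => //; exact: measurable_itv.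
  - move=> x; rewrite /= in_itv/= andbT => rx.
    by rewrite lee_fin ler_wpM2r ?weight_ge0//; apply/small/v1/ltW.
pose K := 2 * expR 2 * Num.sqrt r * (omega theta * r `^ theta).
have K0 : 0 <= K by rewrite mulr_ge0 ?weight_ge0// mulr_ge0 ?sqrtr_ge0// mulr_ge0 ?expR_ge0.
have msq : measurable_fun (`]0, r] : set R) (fun x : R => ((Num.sqrt x)^-1)%:E).
  apply/measurable_EFinP.
  apply: (@measurable_funS _ _ _ _ (`]0, +oo[%classic : set R)) => //.
  apply: open_continuous_measurable_fun; first exact: interval_open.
  move=> x; rewrite inE/= in_itv/= andbT => xp.
  by apply: continuousV; [rewrite gt_eqF// sqrtr_gt0|exact: sqrt_continuous].
have sq0 x : (0 <= ((Num.sqrt x)^-1)%:E :> \bar R)%E.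
  by rewrite lee_fin invr_ge0 sqrtr_ge0.
apply: (@le_trans _ _ (\int[mu]_(x in `]0%R, r]) (K%:E * ((Num.sqrt x)^-1)%:E))%E).
  apply: ge0_le_integral => //.
  - by move=> x _; rewrite lee_fin fge0.
  - apply: measurable_weighted; apply: measurable_funS mf => //; exact: measurable_itv.
  - exact: emeasurable_funM.
  - move=> x; rewrite /= in_itv/= => /andP[xp xr].
    rewrite -EFinM lee_fin [leRHS]mulrAC; apply: ler_pM.
    + exact: sqr_exp_ge0.
    + exact: weight_ge0.
    + exact: sqr_exp_bound.
    + by rewrite ler_pM2l//; apply: ge0_ler_powR => //; rewrite nnegrE ltW.
rewrite ge0_integralZl//.
apply: (@le_trans _ _ (K%:E * (2 * Num.sqrt r)%:E)%E).
  by rewrite lee_wpmul2l//; exact: integral_inv_sqrt_le.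
apply: le_trans (lee_wpmul2l _ (lambda_int_lower_bound t0 k0 x00 mv H vx0 erefl)); last first.
  by rewrite lee_fin ltW.
rewrite -!EFinM lee_fin -/d.
have -> : (d * x0) `^ theta = (d / 2) `^ theta * r `^ theta.
  rewrite -powRM ?(ltW r0) ?divr_ge0 ?(ltW d0)//; congr (_ `^ _).
  by rewrite /r; field.
have sr : Num.sqrt r * Num.sqrt r = r by rewrite -expr2 sqr_sqrtr// ltW.
have P : (d / 2) `^ theta != 0 by rewrite gt_eqF// powR_gt0// divr_gt0.
have D : 1 - d != 0 by rewrite gt_eqF// subr_gt0.
have -> : K * (2 * Num.sqrt r) =
    4 * expR 2 * (omega theta * r `^ theta) * (Num.sqrt r * Num.sqrt r).
  by rewrite /K; ring.
rewrite sr /C1 /r le_eqVlt; apply/orP; left; apply/eqP.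
by field; rewrite P D.
Qed.
End embedding.

(** * Norms, and the spreading test functions *)

Section norms.
Variable R : realType.

Definition energy (beta : R) (u : R -> R) : \bar R :=
  lambda_int beta (fun x => `|u x| ^+ 2).

Lemma energy_ge0 (beta : R) u : 0 <= beta -> (0 <= energy beta u)%E.
Proof. by move=> b0; apply: lambda_int_ge0 => // x; rewrite exprn_ge0. Qed.

Lemma in_L2_energy (beta : R) u : 0 <= beta -> in_L2 beta u ->
  exists2 r, 0 <= r & energy beta u = r%:E.
Proof.
move=> b0 [_]; rewrite /L2_norm -/(energy beta u).
have := energy_ge0 u b0; case: (energy beta u) => [r| |] //.
  by rewrite lee_fin => r0 _; exists r.
by rewrite poweRyr ?invr_neq0// ltxx.
Qed.

Lemma energy_L2_norm_lty (beta : R) u : (energy beta u < +oo)%E ->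
  (L2_norm beta u < +oo)%E.
Proof. by rewrite /L2_norm -/(energy beta u) => h; exact: poweR_lty. Qed.

Lemma L2_norm_sqr (beta r : R) u : 0 <= r -> energy beta u = r%:E ->
  fine (L2_norm beta u) ^+ 2 = r.
Proof.
move=> r0 E; rewrite /L2_norm -/(energy beta u) E poweR_EFin/=.
by rewrite powR12_sqrt// sqr_sqrtr.
Qed.

Lemma W_norm_sqr (theta a b : R) (u : R -> R) : 0 <= a -> 0 <= b ->
  energy 1 (derive1 u) = a%:E -> energy theta u = b%:E ->
  W_norm theta u ^+ 2 = a + b.
Proof.
move=> a0 b0 Ea Eb; rewrite /W_norm sqr_sqrtr ?addr_ge0 ?sqr_ge0//.
by rewrite (L2_norm_sqr a0 Ea) (L2_norm_sqr b0 Eb).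
Qed.

Lemma TM_functional_ge (theta m a b : R) (u : R -> R) : 0 <= theta -> 0 <= m ->
  measurable_fun (`]0, +oo[ : set R) u ->
  0 <= a -> 0 <= b ->
  energy 1 (derive1 u) = a%:E -> energy theta u = b%:E ->
  ((m * b / (a + b))%:E <= TM_functional theta m u)%E.
Proof.
move=> t0 m0 mfu a0 b0 Ea Eb.
have N2 := W_norm_sqr a0 b0 Ea Eb.
have c0 : 0 <= m / (a + b) by rewrite divr_ge0// addr_ge0.
rewrite mulrAC EFinM -Eb /energy /lambda_int -ge0_integralZl//; last 2 first.
- by apply: measurable_weighted; apply: measurable_funX; exact: measurableT_comp.
- by move=> x _; rewrite lee_fin mulr_ge0 ?exprn_ge0 ?weight_ge0.
apply: ge0_le_integral => //.
- by move=> x _; rewrite mule_ge0// lee_fin mulr_ge0 ?exprn_ge0 ?weight_ge0.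
- apply: emeasurable_funM => //; apply: measurable_weighted.
  by apply: measurable_funX; exact: measurableT_comp.
- apply: measurable_weighted; apply: measurable_funB => //.
  apply: measurableT_comp => //; apply: measurable_funM => //.
  apply: measurable_funX; apply: measurable_funM => //; exact: measurableT_comp.
- move=> x _; rewrite -EFinM lee_fin [leLHS]mulrA ler_wpM2r ?weight_ge0// /A2.
  rewrite expr_div_n N2; have := expR_ge1Dx (m * (`|u x| ^+ 2 / (a + b))).
  by rewrite [m / (a + b) * _]mulrAC -[m * _ / _]mulrA; lra.
Qed.
End norms.

Section hat.
Variable R : realType.
Local Notation mu := (@lebesgue_measure R).
Variable T : R.
Hypothesis T0 : 0 < T.

(** Stretching by [T] leaves the norm of the derivative in [L^2_1] unchanged and
multiplies the squared norm in [L^2_theta] by [T^(theta + 1)]. *)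
Definition hat (x : R) := Num.max 0 (1 - x / T).

Lemma hat_lipschitz x y : x <= y -> `|hat y - hat x| <= (y - x) / T.
Proof.
move=> xy; have : x / T <= y / T by rewrite ler_pM2r// invr_gt0.
rewrite mulrBl /hat /Order.max => h.
by do ! case: ifPn; rewrite -?leNgt => h1 h2; rewrite ler_norml; apply/andP; split; lra.
Qed.

Lemma hat_abs_continuous : loc_abs_continuous hat.
Proof.
move=> a b a0 ab e e0; exists (e * T) => [|n x y H _ S]; first exact: mulr_gt0.
apply: (@le_lt_trans _ _ (\sum_(i < n) (y i - x i) / T)).
  by apply: ler_sum => i _; apply: hat_lipschitz; have [] := H i.
by rewrite -mulr_suml ltr_pdivrMr.
Qed.

Lemma hat_affine x : x <= T -> hat x = 1 - x / T.
Proof. by move=> xT; rewrite /hat max_r// subr_ge0 ler_pdivrMr// mul1r. Qed.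

Lemma hat_eq0 x : T <= x -> hat x = 0.
Proof. by move=> xT; rewrite /hat max_l// subr_le0 ler_pdivlMr// mul1r. Qed.

Lemma derive1_hat_lt x : x < T -> derive1 hat x = - T^-1.
Proof.
move=> xT; rewrite derive1E (@near_eq_derive _ _ _ hat (cst 1 - T^-1 *: @id R)).
  rewrite deriveB; [|exact: derivable_cst|by apply: derivableZ; exact: derivable_id].
  rewrite derive_cst sub0r deriveZ; last exact: derivable_id.
  by rewrite derive_id scaler1.
near=> y; rewrite hat_affine; first by rewrite mulrC.
by apply: ltW; near: y; exact: lt_nbhsl.
Unshelve. all: by end_near. Qed.

Lemma derive1_hat_gt x : T < x -> derive1 hat x = 0.
Proof.
move=> xT; rewrite derive1E (@near_eq_derive _ _ _ hat (cst 0)) ?derive_cst//.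
near=> y; rewrite hat_eq0//; apply: ltW; near: y; exact: lt_nbhsr.
Unshelve. all: by end_near. Qed.

Lemma measurable_hat (A : set R) : measurable_fun A hat.
Proof.
apply: (measurable_funS measurableT) => //; apply: measurable_maxr => //.
by apply: measurable_funB => //; exact: measurable_funM.
Qed.

Lemma positive_axis_split : (`]0, +oo[%classic : set R) =
  `]0, T[%classic `|` ([set T] `|` `]T, +oo[%classic).
Proof.
apply/seteqP; split => x /=; rewrite !in_itv/= !andbT.
  move=> x0; have [xT|xT|->] := ltgtP x T; [|by right; right|by right; left].
  by left; rewrite x0.
by move=> [/andP[]//|[->//|]]; exact: lt_trans.
Qed.

Lemma measurable_derive1_hat : measurable_fun (`]0, +oo[ : set R) (derive1 hat).
Proof.
rewrite positive_axis_split; apply/measurable_funU => //.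
  by apply: measurableU => //; exact: measurable_itv.
split.
  apply: (@eq_measurable_fun _ _ _ _ _ (cst (- T^-1))) => // x.
  by rewrite inE/= in_itv/= => /andP[_ xT]; rewrite derive1_hat_lt.
apply/measurable_funU => //; split; first exact: measurable_fun_set1.
apply: (@eq_measurable_fun _ _ _ _ _ (cst (0 : R))) => // x.
by rewrite inE/= in_itv/= andbT => xT; rewrite derive1_hat_gt.
Qed.

Lemma hat_cvg0 : hat x @[x --> +oo] --> (0 : R).
Proof.
apply: cvg_near_cst; near=> x; apply: hat_eq0.
by near: x; apply: nbhs_pinfty_ge; exact: num_real.
Unshelve. all: by end_near. Qed.

Lemma hat_nonzero : nonzero hat.
Proof.
exists (T / 2); first by rewrite divr_gt0.
by rewrite hat_affine ?ler_piMr ?invf_le1 ?ler1n// ?ltW// mulrAC divff ?gt_eqF//; lra.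
Qed.

Lemma lambda_int_supported_le (beta M : R) (f : R -> R) : 0 <= beta ->
  measurable_fun (`]0, +oo[ : set R) f -> (forall x, 0 <= f x) ->
  (forall x, 0 < x -> x < T -> f x <= M) -> (forall x, T < x -> f x = 0) ->
  (lambda_int beta f <= (M * (omega beta * T `^ beta) * T)%:E)%E.
Proof.
move=> b0 mf f0 fM fT; have w0 := omega_gt0 b0.
have fw0 x : (0 <= (f x * (omega beta * x `^ beta))%:E)%E.
  by rewrite lee_fin mulr_ge0 ?weight_ge0.
have mfw := measurable_weighted beta mf.
rewrite /lambda_int (@itv_bndbnd_setU _ _ _ (BRight T))//; last first.
  by rewrite bnd_simp ltW.
rewrite ge0_integral_setU//; last 2 first.
- by rewrite -itv_bndbnd_setU// bnd_simp ltW.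
- apply/disj_setPLR => x /=; rewrite !in_itv/= andbT => /andP[_ xr].
  by apply/negP; rewrite -leNgt.
rewrite [X in (_ + X)%E](_ : _ = 0%E) ?adde0; last first.
  apply: integral0_eq => x; rewrite /= in_itv/= andbT => Tx.
  by rewrite fT// mul0r.
have mfT : measurable_fun (`]0, T[ : set R)
    (fun x => (f x * (omega beta * x `^ beta))%:E).
  apply: measurable_funS mfw; first exact: measurable_itv.
  by move=> x; rewrite /= !in_itv/= andbT => /andP[].
rewrite -integral_itv_bndo_bndc//.
apply: (@le_trans _ _ (\int[mu]_(x in `]0%R, T[)
    (cst (M * (omega beta * T `^ beta))%:E x))%E).
  apply: ge0_le_integral => // x; rewrite /= in_itv/= => /andP[x0 xT].
  rewrite lee_fin ler_pM ?weight_ge0 ?fM// ler_pM2l//.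
  by apply: ge0_ler_powR => //; rewrite ?nnegrE ltW.
by rewrite integral_cst//= lebesgue_measure_itv/= lte_fin T0 oppr0 adde0 -EFinM.
Qed.

Lemma energy_derive1_hat_le : (energy 1 (derive1 hat) <= (omega 1)%:E)%E.
Proof.
apply: le_trans (lambda_int_supported_le (M := T^-1 ^+ 2) _ _ _ _ _) _ => //.
- by apply: measurable_funX; apply: measurableT_comp => //; exact: measurable_derive1_hat.
- by move=> x x0 xT; rewrite derive1_hat_lt// normrN ger0_norm// invr_ge0 ltW.
- by move=> x Tx; rewrite derive1_hat_gt// normr0 expr0n.
rewrite lee_fin powRr1 ?(ltW T0)// le_eqVlt; apply/orP; left; apply/eqP.
by field; rewrite gt_eqF.
Qed.

Lemma hat_ge0 x : 0 <= hat x.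
Proof. by rewrite le_max lexx. Qed.

Lemma energy_hat_lty (theta : R) : 0 <= theta -> (energy theta hat < +oo)%E.
Proof.
move=> t0.
apply: le_lt_trans (lambda_int_supported_le (M := 1) t0 _ _ _ _) (ltry _).
- by apply: measurable_funX; apply: measurableT_comp => //; exact: measurable_hat.
- by move=> x; rewrite exprn_ge0.
- move=> x x0 xT; rewrite ger0_norm ?hat_ge0//; apply: exprn_ile1; first exact: hat_ge0.
  by rewrite hat_affine ?(ltW xT)// lerBlDr lerDl divr_ge0// ltW.
- by move=> x Tx; rewrite hat_eq0 ?ltW// normr0 expr0n.
Qed.

Lemma energy_hat_ge (theta : R) : 0 <= theta -> 2 < T ->
  ((4^-1 * omega theta * (T / 2 - 1))%:E <= energy theta hat)%E.
Proof.
move=> t0 T2; have w0 := omega_gt0 t0.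
have mh : measurable_fun (`]0, +oo[ : set R) (fun x => `|hat x| ^+ 2).
  by apply: measurable_funX; apply: measurableT_comp => //; exact: measurable_hat.
have sub : `]1, T / 2[ `<=` (`]0, +oo[ : set R).
  by move=> x; rewrite /= !in_itv/= andbT => /andP[/(lt_trans ltr01)].
apply: (@le_trans _ _ (\int[mu]_(x in `]1%R, (T / 2)%R[)
    (`|hat x| ^+ 2 * (omega theta * x `^ theta))%:E)%E); last first.
  apply: ge0_subset_integral => //; first exact: measurable_weighted.
  by move=> x _; rewrite lee_fin mulr_ge0 ?exprn_ge0 ?weight_ge0.
apply: (@le_trans _ _ (\int[mu]_(x in `]1%R, (T / 2)%R[)
    (cst (4^-1 * omega theta)%:E x))%E).
  rewrite integral_cst//= lebesgue_measure_itv/= lte_fin.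
  have -> : 1 < T / 2 by lra.
  by rewrite -EFinB -EFinM.
apply: ge0_le_integral => //.
- by move=> x _; rewrite lee_fin mulr_ge0 ?invr_ge0// ltW.
- apply: measurable_weighted; apply: measurable_funS mh => //; exact: measurable_itv.
- move=> x; rewrite /= in_itv/= => /andP[x1 xT2].
  have xT : x / T <= 2^-1 by rewrite ler_pdivrMr//; lra.
  rewrite lee_fin; apply: ler_pM; rewrite ?invr_ge0// ?(ltW w0)//.
    rewrite ger0_norm ?hat_ge0// hat_affine; last by lra.
    have -> : (4^-1 : R) = 2^-1 ^+ 2 by rewrite exprVn -natrX.
    by rewrite ler_pXn2r ?nnegrE ?invr_ge0//; lra.
  rewrite ler_peMr ?(ltW w0)//; rewrite -(powRr0 x); apply: ler_powR => //.
  exact: ltW.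
Qed.

Lemma hat_in_W (theta : R) : 0 <= theta -> in_W theta hat.
Proof.
move=> t0; split.
- by split; [exact: measurable_hat|exact/energy_L2_norm_lty/energy_hat_lty].
- exact: hat_abs_continuous.
- split; first exact: measurable_derive1_hat.
  by apply: energy_L2_norm_lty; apply: le_lt_trans energy_derive1_hat_le (ltry _).
- exact: hat_cvg0.
Qed.
End hat.

(** * Values of the functional *)

Section main_estimates.
Variable R : realType.
Local Notation mu := (@lebesgue_measure R).

(** Hat functions have derivatives of energy at most [omega 1], while their own energy [b]
exceeds [omega 1 / e] when [T] is large; then [b / (a + b) >= 1 - e]. *)
Lemma TM_sup_ge (theta m e : R) : 0 <= theta -> 0 < m -> 0 < e ->
  ((m * (1 - e))%:E <= TM_sup theta m)%E.
Proof.
move=> t0 m0 e0.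
have w0 := omega_gt0 t0; have w1 : 0 < omega (1 : R) by exact: omega_gt0.
pose T := 2 * (1 + 4 * (omega 1 / (omega theta * e))).
have T2 : 2 < T.
  have : 0 < omega 1 / (omega theta * e) by rewrite divr_gt0// mulr_gt0.
  by rewrite /T; lra.
have T0 : 0 < T by lra.
have [L2 _ L2' _] := hat_in_W T0 t0.
have [b b0 Eb] := in_L2_energy t0 L2.
have [a a0 Ea] := in_L2_energy ler01 L2'.
have a1 : a <= omega 1 by rewrite -lee_fin -Ea energy_derive1_hat_le.
have be : omega 1 / e <= b.
  rewrite -lee_fin -Eb; apply: le_trans (energy_hat_ge T0 t0 T2).
  rewrite lee_fin le_eqVlt; apply/orP; left; apply/eqP; rewrite /T.
  by field; rewrite !gt_eqF.
have b1 : 0 < b by apply: lt_le_trans be; rewrite divr_gt0.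
apply: (@le_trans _ _ (TM_functional theta m (hat T))); last first.
  apply: ereal_sup_ubound; exists (hat T) => //; split.
    exact: hat_in_W.
  exact: hat_nonzero.
have := TM_functional_ge t0 (ltW m0) (@measurable_hat R T _) a0 b0 Ea Eb.
apply: le_trans.
rewrite lee_fin -mulrA ler_wpM2l ?(ltW m0)//.
rewrite ler_pdivlMr ?ltr_wpDl//.
move: be; rewrite ler_pdivrMr// => be.
nra.
Qed.

(** If [a = 0] all increments vanish, so [u] is constant on the half-line, and it tends
to [0]. *)
Lemma energy_derivative_gt0 (u : R -> R) (k a : R) : 0 <= a ->
  (forall x y, 0 < x -> x < y -> (u y - u x) ^+ 2 <= a * k * (ln y - ln x)) ->
  u x @[x --> +oo] --> (0 : R) -> nonzero u -> 0 < a.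
Proof.
rewrite le_eqVlt => /predU1P[<- H u0 [x x0]|//]; apply: contra_neqT => _.
suff ux : u y @[y --> +oo] --> u x by exact: (cvg_unique _ ux u0).
apply: cvg_near_cst; near=> y.
have xy : x < y by near: y; apply: nbhs_pinfty_gt; exact: num_real.
have := H x y x0 xy; rewrite !mul0r -[X in _ <= X]/0 real_exprn_even_le0//=.
by rewrite subr_eq0 => /eqP.
Unshelve. all: by end_near. Qed.

(** The exponent [m u^2 / (a + b)] is [s (c v^2)] with [v = u / sqrt a] and
[s = m a / ((a + b) c) <= 1].  Hence the remainder is at most [s^2] times the left side
of the exponential inequality for [v], that is [s^2 C b / a]; one factor [a] of
[s^2] survives, and the smallness of [m] makes this at most
[m a / (2 (a + b))]. *)
Lemma TM_functional_le (theta m a b : R) (u : R -> R) (k := (omega 1)^-1)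
    (c := embedding_exponent k) (C := embedding_constant theta k) :
  0 <= theta -> 0 < m -> m <= c -> 2 * C * m <= c ^+ 2 ->
  in_W theta u -> 0 < a -> 0 <= b ->
  energy 1 (derive1 u) = a%:E -> energy theta u = b%:E ->
  (TM_functional theta m u <= (m * (1 - a / (2 * (a + b))))%:E)%E.
Proof.
move=> t0 m0 mc mC [[mfu _] acu [mdu _] u0] a0 b0 Ea Eb.
have w1 : 0 < omega (1 : R) by exact: omega_gt0.
have k0 : 0 < k by rewrite invr_gt0.
have c0 : 0 < c := lt_le_trans m0 mc.
have N2 := W_norm_sqr (ltW a0) b0 Ea Eb.
have ab0 : 0 < a + b by rewrite ltr_wpDr.
have sa0 : 0 < Num.sqrt a by rewrite sqrtr_gt0.
pose v x := u x / Num.sqrt a.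
have v2 x : v x ^+ 2 = a^-1 * `|u x| ^+ 2.
  by rewrite /v expr_div_n sqr_sqrtr ?ltW// real_normK ?num_real// mulrC.
have mv : measurable_fun (`]0, +oo[ : set R) v by exact: measurable_funM.
have Hv x y : 0 < x -> x < y -> (v y - v x) ^+ 2 <= k * (ln y - ln x).
  move=> x0 xy; have := increment_sqr_le acu mdu Ea x0 xy.
  rewrite /v -mulrBl expr_div_n (sqr_sqrtr (ltW a0)) ler_pdivrMr// => h.
  by apply: le_trans h _; rewrite /k; lra.
have v0 : v x @[x --> +oo] --> (0 : R).
  by rewrite -(mul0r (Num.sqrt a)^-1); apply: cvgMl.
have mfu2 : measurable_fun (`]0, +oo[ : set R) (fun x => `|u x| ^+ 2).
  by apply: measurable_funX; exact: measurableT_comp.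
have Ev : lambda_int theta (fun x => v x ^+ 2) = (b / a)%:E.
  rewrite mulrC EFinM -Eb /energy /lambda_int -ge0_integralZl//.
  - by apply: eq_integral => x _; rewrite v2 -EFinM -mulrA.
  - exact: measurable_weighted.
  - by move=> x _; rewrite lee_fin mulr_ge0 ?exprn_ge0 ?weight_ge0.
  - by rewrite lee_fin invr_ge0 ltW.
have := sqr_exp_integral_le t0 k0 mv Hv v0; rewrite Ev -/c -/C => emb.
pose s := m * a / ((a + b) * c).
have s0 : 0 <= s by rewrite divr_ge0 ?mulr_ge0// ltW.
have s1 : s <= 1.
  rewrite ler_pdivrMr ?mulr_gt0// mul1r mulrC.
  by apply: ler_pM => //; [exact: ltW|exact: ltW|rewrite lerDl].
have mg : measurable_fun (`]0, +oo[ : set R) (fun x => sqr_exp (c * v x ^+ 2)).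
  apply: measurable_funM.
    by apply: measurable_funX; apply: measurable_funM => //; exact: measurable_funX.
  apply: measurableT_comp => //; apply: measurable_funM => //; exact: measurable_funX.
have ma0 : 0 <= m / (a + b) by rewrite divr_ge0// ltW.
pose F1 x := (`|u x| ^+ 2 * (omega theta * x `^ theta))%:E.
pose F2 x := (sqr_exp (c * v x ^+ 2) * (omega theta * x `^ theta))%:E.
have F10 x : (0 <= F1 x)%E by rewrite lee_fin mulr_ge0 ?exprn_ge0 ?weight_ge0.
have F20 x : (0 <= F2 x)%E by rewrite lee_fin mulr_ge0 ?sqr_exp_ge0 ?weight_ge0.
have mF1 : measurable_fun (`]0, +oo[ : set R) F1 by exact: measurable_weighted.
have mF2 : measurable_fun (`]0, +oo[ : set R) F2 by exact: measurable_weighted.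
apply: (@le_trans _ _ (\int[mu]_(x in `]0%R, +oo[)
    ((m / (a + b))%:E * F1 x + (s ^+ 2)%:E * F2 x))%E).
  apply: ge0_le_integral => //.
  - move=> x _; rewrite lee_fin mulr_ge0 ?weight_ge0// /A2 subr_ge0 -expR0.
    by rewrite ler_expR mulr_ge0 ?sqr_ge0// ltW.
  - apply: measurable_weighted; apply: measurable_funB => //.
    apply: measurableT_comp => //; apply: measurable_funM => //.
    apply: measurable_funX; apply: measurable_funM => //; exact: measurableT_comp.
  - by apply: emeasurable_funD; apply: emeasurable_funM.
  - move=> x _; rewrite /F1 /F2 -!EFinM -EFinD lee_fin.
    rewrite [X in _ <= X + _]mulrA [X in _ <= _ + X]mulrA -mulrDl.
    rewrite ler_wpM2r ?weight_ge0// /A2 expr_div_n N2.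
    set z := `|u x| ^+ 2.
    have z0 : 0 <= z by rewrite exprn_ge0.
    have st : m * (z / (a + b)) = s * (c * v x ^+ 2).
      by rewrite v2 -/z /s; field; rewrite !gt_eqF.
    have cv0 : 0 <= c * v x ^+ 2 by rewrite mulr_ge0 ?sqr_ge0// ltW.
    have h1 := expR_remainder_le (mulr_ge0 s0 cv0).
    have h2 := sqr_expM_le s0 s1 cv0.
    have h3 : m / (a + b) * z = s * (c * v x ^+ 2) by rewrite -st; ring.
    by rewrite st h3; lra.
rewrite ge0_integralD//; first last.
- exact: emeasurable_funM.
- by move=> x _; rewrite mule_ge0// lee_fin sqr_ge0.
- exact: emeasurable_funM.
- by move=> x _; rewrite mule_ge0.
rewrite !ge0_integralZl//; last by rewrite lee_fin sqr_ge0.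
rewrite -[X in (_ * X + _)%E]/(energy theta u) Eb.
apply: (@le_trans _ _ ((m / (a + b))%:E * b%:E + (s ^+ 2)%:E * (C%:E * (b / a)%:E))%E).
  by rewrite leeD2l// lee_wpmul2l// lee_fin sqr_ge0.
rewrite -!EFinM -EFinD lee_fin.
have -> : s ^+ 2 * (C * (b / a)) =
    (2 * C * m / c ^+ 2) * (b / (a + b)) * (m * a / (2 * (a + b))).
  by rewrite /s; field; rewrite !gt_eqF.
have h1 : 2 * C * m / c ^+ 2 <= 1 by rewrite ler_pdivrMr ?exprn_gt0// mul1r.
have h2 : b / (a + b) <= 1 by rewrite ler_pdivrMr// mul1r lerDr ltW.
have h20 : 0 <= b / (a + b) by rewrite divr_ge0// ltW.
have h3 : 2 * C * m / c ^+ 2 * (b / (a + b)) <= 1.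
  by apply: le_trans h2; rewrite -[leRHS]mul1r ler_wpM2r.
have h4 : 0 <= m * a / (2 * (a + b)) by rewrite divr_ge0 ?mulr_ge0// ltW.
have h5 : 2 * C * m / c ^+ 2 * (b / (a + b)) * (m * a / (2 * (a + b))) <=
   m * a / (2 * (a + b)) by rewrite -[leRHS]mul1r ler_wpM2r.
apply: le_trans (_ : m / (a + b) * b + m * a / (2 * (a + b)) <= _).
  by rewrite lerD2l.
rewrite le_eqVlt; apply/orP; left; apply/eqP.
by field; rewrite gt_eqF.
Qed.
End main_estimates.

Theorem theorem1p3 (R : realType) (theta : R) (htheta : 0 <= theta) :
  exists mu0 : R, 0 < mu0 /\
    forall mu : R, 0 < mu -> mu < mu0 ->
      ~ exists u : R -> R,
          [/\ in_W theta u, nonzero u &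
              TM_functional theta mu u = TM_sup theta mu].
Proof.
pose k : R := (omega 1)^-1.
pose c := embedding_exponent k; pose C := embedding_constant theta k.
have w1 : 0 < omega (1 : R) by exact: omega_gt0.
have k0 : 0 < k by rewrite invr_gt0.
have c0 : 0 < c by rewrite lt_min !invr_gt0 mulr_gt0// ltr0n.
have C0 : 0 < C.
  rewrite /C /embedding_constant addr_gt0// divr_gt0 ?mulr_gt0 ?expR_gt0//.
    by rewrite powR_gt0// divr_gt0 ?expR_gt0.
  by rewrite subr_gt0 -expR0 ltr_expR oppr_lt0 invr_gt0 mulr_gt0.
exists (Num.min c (c ^+ 2 / (2 * C))); split.
  by rewrite lt_min c0 divr_gt0 ?exprn_gt0// mulr_gt0.
move=> m m0; rewrite lt_min => /andP[mc]; rewrite ltr_pdivlMr ?mulr_gt0// => mC.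
move=> [u [Wu nu]]; have [L2 acu L2' u0] := Wu.
have [b b0 Eb] := in_L2_energy htheta L2.
have [a a0 Ea] := in_L2_energy ler01 L2'.
have {}a0 : 0 < a.
  apply: (energy_derivative_gt0 a0 _ u0 nu) => x y x0 xy.
  exact: (increment_sqr_le acu L2'.1 Ea x0 xy).
have ab0 : 0 < a + b by rewrite ltr_wpDr.
pose e := a / (4 * (a + b)).
have e0 : 0 < e by rewrite divr_gt0// mulr_gt0.
apply/eqP; rewrite lt_eqF//.
apply: le_lt_trans (TM_functional_le htheta m0 (ltW mc) _ Wu a0 b0 Ea Eb) _.
  by rewrite mulrC ltW.
apply: lt_le_trans (TM_sup_ge htheta m0 e0).
rewrite lte_fin ltr_pM2l// ltrD2l ltrN2 /e ltr_pM2l// ltf_pV2 ?posrE ?mulr_gt0//.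
by rewrite ltr_pM2r// ltr_nat.
Qed.
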